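(* Let $\mathbf K'_1$ be the class of barycentric subdivisions of cliques with at least four vertices and $\mathbf K_1$ the class of right-angled Coxeter groups whose Coxeter graph is in $\mathbf K'_1$. Then $(\mathbf K_1,\preccurlyeq)$ is tame.
   Context: The barycentric subdivision $\hat\Gamma$ of a graph $\Gamma=(V,E)$ has vertex set the disjoint union of $V$ and $\{c_{a,b}: aEb\}$, with $N(c_{a,b})=\{a,b\}$ and $N(a)=\{c_{a,b}: aEb\}$. A right-angled Coxeter group has a presentation with generating set $S$ (Coxeter basis) and only relations $s^2=e$, $(ss')^2=e$ for some pairs of distinct $s,s'$; its Coxeter graph has vertex set $S$, distinct vertices adjacent iff they commute. $A\preccurlyeq B$ iff $A$ is a subgroup of $B$ and some Coxeter basis $S$ of $B$ has $A\cap S$ a Coxeter basis of $A$. $(\mathbf K_1,\preccurlyeq)$ is an abstract elementary class with amalgamation, joint embedding, arbitrarily large models and Löwenheim–Skolem number $\omega$; $\mathfrak M$ is its monster model; Galois types: $tp(a/A)=tp(b/A)$ iff some automorphism of $\mathfrak M$ fixing $A$ pointwise maps $a$ to $b$. Tame: for every $\lambda\ge\omega$, every $B\in\mathbf K_1$ of cardinality $\lambda$ with $B\preccurlyeq\mathfrak M$ and finite tuples $a,b$ from $\mathfrak M$ with $tp(a/B)\neq tp(b/B)$, there is a countable $A\preccurlyeq B$ with $tp(a/A)\ne tp(b/A)$. *)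

(* Defs.v *)
From HB Require Import structures.
From mathcomp Require Import all_boot.
From mathcomp Require Import boolp classical_sets functions cardinality.

Set Implicit Arguments.
Unset Strict Implicit.
Unset Printing Implicit Defensive.

Local Open Scope classical_set_scope.
Local Open Scope card_scope.
Local Open Scope group_scope.

Definition card_lt (T U : Type) (A : set T) (B : set U) : Prop :=
  A #<= B /\ ~ (B #<= A).

(** * Graphs *)

Record graph := Graph {
  vertex : Type;
  adj : vertex -> vertex -> Prop;
  adj_sym : forall a b, adj a b -> adj b a;
  adj_irrefl : forall a, ~ adj a a
}.

Definition graph_iso (Gamma Delta : graph) : Prop :=
  exists f : vertex Gamma -> vertex Delta,
    bijective f /\ forall a b, adj a b <-> adj (f a) (f b).

Definition is_clique (Gamma : graph) : Prop :=
  forall a b : vertex Gamma, a <> b -> adj a b.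

Section Barycentric.
Variable Gamma : graph.

(* The new vertex c_{a,b} = c_{b,a} is the unordered pair {a, b}. *)
Definition is_edge (e : set (vertex Gamma)) : Prop :=
  exists a b, adj a b /\ e = [set a; b].

Definition bary_vertex : Type := (vertex Gamma + {e | is_edge e})%type.

Definition bary_adj (x y : bary_vertex) : Prop :=
  match x, y with
  | inl a, inr c => sval c a
  | inr c, inl a => sval c a
  | _, _ => False
  end.

Lemma bary_adj_sym x y : bary_adj x y -> bary_adj y x.
Proof. by case: x y => [a|c] [b|d]. Qed.

Lemma bary_adj_irrefl x : ~ bary_adj x x.
Proof. by case: x => ? []. Qed.

Definition barycentric_subdivision : graph :=
  Graph bary_adj_sym bary_adj_irrefl.
End Barycentric.

Definition K1' (Gamma : graph) : Prop :=
  exists Delta : graph,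
    [/\ is_clique Delta, [set: 'I_4] #<= [set: vertex Delta]
      & graph_iso Gamma (barycentric_subdivision Delta)].

(** * Group presentations *)

(* The letter (x, false) stands for x, and (x, true) for its formal inverse. *)
Definition word (X : Type) : Type := seq (X * bool).

(* Equality of words in the group < X | R >. *)
Inductive word_eq (X : Type) (R : set (word X)) : word X -> word X -> Prop :=
| word_eq_refl w : word_eq R w w
| word_eq_sym w1 w2 : word_eq R w1 w2 -> word_eq R w2 w1
| word_eq_trans w1 w2 w3 :
    word_eq R w1 w2 -> word_eq R w2 w3 -> word_eq R w1 w3
| word_eq_cancel u v x e :
    word_eq R (u ++ [:: (x, e); (x, ~~ e)] ++ v) (u ++ v)
| word_eq_relator u v r : R r -> word_eq R (u ++ r ++ v) (u ++ v).

Definition word_eval (G : groupType) (X : Type) (i : X -> G) (w : word X) : G :=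
  \prod_(l <- w) (if l.2 then (i l.1)^-1 else i l.1).

(* The map i from X to G induces an isomorphism of < X | R > onto H. *)
Definition presents (G : groupType) (X : Type) (i : X -> G)
    (R : set (word X)) (H : set G) : Prop :=
  range (word_eval i) = H /\
  forall w, word_eval i w = 1 <-> word_eq R w [::].

(** * Right-angled Coxeter groups *)

Inductive coxeter_relator (X : Type) (E : X -> X -> Prop) : set (word X) :=
| coxeter_relator_sq s : coxeter_relator E [:: (s, false); (s, false)]
| coxeter_relator_comm s t : s <> t -> E s t ->
    coxeter_relator E [:: (s, false); (t, false); (s, false); (t, false)].

(* The groups under consideration are subgroups H of some ambient group G,
   so that the intersections in the strong subgroup relation make sense;
   H = [set: G] is the case of a group by itself. *)
Definition coxeter_basis (G : groupType) (H S : set G) : Prop :=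
  exists E : S -> S -> Prop,
    presents (fun s : S => val s) (coxeter_relator E) H.

Section CoxeterGraph.
Variables (G : groupType) (S : set G).

Definition coxeter_adj (s t : S) : Prop := s <> t /\ commute (val s) (val t).

Lemma coxeter_adj_sym s t : coxeter_adj s t -> coxeter_adj t s.
Proof. by move=> [neq_st cst]; split=> // /esym. Qed.

Lemma coxeter_adj_irrefl s : ~ coxeter_adj s s.
Proof. by case. Qed.

Definition coxeter_graph : graph := Graph coxeter_adj_sym coxeter_adj_irrefl.
End CoxeterGraph.

Definition K1 (G : groupType) (H : set G) : Prop :=
  exists S : set G, coxeter_basis H S /\ K1' (coxeter_graph S).

Definition is_subgroup (G : groupType) (A : set G) : Prop :=
  [/\ A 1, forall x y, A x -> A y -> A (x * y) & forall x, A x -> A x^-1].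

Definition strong (G : groupType) (A B : set G) : Prop :=
  [/\ A `<=` B, is_subgroup A
    & exists S : set G, coxeter_basis B S /\ coxeter_basis A (A `&` S)].

(** * Monster models, Galois types and tameness *)

Section Tame.
Variables (K : forall G : groupType, set G -> Prop)
          (le : forall G : groupType, set G -> set G -> Prop).

Definition automorphism (M : groupType) (F : M -> M) : Prop :=
  bijective F /\ {morph F : x y / x * y}.

(* f restricts to a group isomorphism of A onto B. *)
Definition iso_on (G : groupType) (A B : set G) (f : G -> G) : Prop :=
  [/\ f @` A = B, {in A &, injective f}
    & {in A &, {morph f : x y / x * y}}].

(* For the uncountable cardinal |kappa|, M is kappa-universal and strongly
   kappa-homogeneous with respect to strong embeddings of members of K. *)
Definition monster (kappa : Type) (M : groupType) : Prop :=
  [/\ ~ countable [set: kappa],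
      K [set: M],
      forall N : groupType, K [set: N] -> card_lt [set: N] [set: kappa] ->
        exists f : N -> M,
          [/\ injective f, {morph f : x y / x * y}
            & K (range f) /\ le (range f) [set: M]]
    & forall (A B : set M) (f : M -> M),
        K A -> K B -> le A [set: M] -> le B [set: M] ->
        card_lt A [set: kappa] -> iso_on A B f ->
        exists F : M -> M, automorphism F /\ {in A, F =1 f}].

(* tp(a/A) = tp(b/A), for finite tuples a and b. *)
Definition same_galois_type (M : groupType) (A : set M) (a b : seq M) : Prop :=
  exists F : M -> M,
    [/\ automorphism F, {in A, forall x, F x = x} & map F a = b].

Definition tame (M : groupType) : Prop :=
  forall B : set M, K B -> infinite_set B -> le B [set: M] ->
  forall a b : seq M, ~ same_galois_type B a b ->
  exists A : set M,
    [/\ K A, countable A, le A B & ~ same_galois_type A a b].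
End Tame.

(* Main.v *)
From Stdlib Require Import ZArith Lia.
Require Import Defs.
From mathcomp Require Import all_boot.
From mathcomp Require Import boolp classical_sets functions cardinality.

(** The point is strong rigidity: if the Coxeter graph of [S] is the barycentric subdivision of a
    clique with at least four vertices, then every Coxeter basis [S'] of the group generated by
    [S] is conjugate to [S].  Comparing centralizers of involutions shows that [S] and [S'] define
    the same reflections.  Deleting the star of a vertex [s] from the subdivision leaves a
    connected graph, so the walls (in the Cayley graph of [S']) of the elements of [S] that do not
    commute with [s] all lie on one side of the wall of [s]; some chamber lies on the preferred
    side of all walls of [S], and a ping-pong argument shows that these walls bound it.

    Hence an automorphism of the monster that fixes a special subgroup on at least four clique
    vertices is induced by a permutation of the clique.  If it maps a tuple [a] to [b] and fixes
    the finitely many vertices of [B] in the supports of [a] and [b], the permutation can be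
    changed outside the support of [a] so as to fix all vertices of [B]. *)

Set Implicit Arguments.
Unset Strict Implicit.
Unset Printing Implicit Defensive.

Local Open Scope classical_set_scope.
Local Open Scope card_scope.
Local Open Scope group_scope.

(** * Words and the universal property *)

(** Rigidity is used twice. [K1] and [strong] each supply some Coxeter basis, and only conjugacy of
    bases puts the subdivision structure on the basis that the monster shares with [B]. Later it
    compares a basis with its image under an automorphism; fixing four vertices forces the
    conjugating element to be 1.

    Two obstacles shape its proof. A basis might contain a product [a c] of commuting letters in
    place of a letter; centralizers exclude this because every vertex lies on several edges and
    every edge has a second end. And the rank may be infinite, while a chamber is moved across one
    wall at a time: only finitely many walls are misoriented at the start, since each of them
    separates 1 from one of two fixed chambers.

    In the final step a vertex of the support of [a] outside [B] might be sent into [B]. If its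
    image is in the support of [b], the image is a fixed vertex, against injectivity; if not, the
    letters that involve this vertex can be deleted from the words of [a]. *)

Section Words.
Variable G : groupType.
Implicit Types (x y r s t g h : G) (l p q : seq G) (S H : set G).

Definition wprod l : G := foldr *%g 1 l.

Definition word_on S l : Prop := forall x, x \in l -> S x.

Lemma wprod_cat l l' : wprod (l ++ l') = wprod l * wprod l'.
Proof. by elim: l => [|x l IH] /=; rewrite ?mul1g // IH mulgA. Qed.

Lemma word_on_nil S : word_on S [::].
Proof. by []. Qed.

Lemma word_on_cons S x l : word_on S (x :: l) <-> S x /\ word_on S l.
Proof.
split=> [h|[hx hl] y].
  by split=> [|y yl]; apply: h; rewrite inE ?eqxx ?yl ?orbT.
by rewrite inE => /orP[/eqP->|/hl].
Qed.

Lemma word_on_cat S l l' : word_on S (l ++ l') <-> word_on S l /\ word_on S l'.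
Proof.
split=> [h|[hl hl'] y]; last by rewrite mem_cat => /orP[/hl|/hl'].
by split=> y yl; apply: h; rewrite mem_cat yl ?orbT.
Qed.

Lemma word_on_rev S l : word_on S l -> word_on S (rev l).
Proof. by move=> h x; rewrite mem_rev; apply: h. Qed.

Lemma wprod_rev S l : (forall s, S s -> s * s = 1) -> word_on S l ->
  wprod (rev l) = (wprod l)^-1.
Proof.
move=> sq; elim: l => [|x l IH] /=; first by rewrite invg1.
move=> /word_on_cons[Sx /IH e]; rewrite rev_cons -cats1 wprod_cat e /= mulg1 invgM.
by congr (_ * _); apply/esym/mulg1_eq/sq.
Qed.

Lemma commuteE x y : commute x y <-> x ^ y = x.
Proof.
rewrite /commute conjgE; split=> [->|e]; first by rewrite mulKg.
by rewrite -{2}e mulVKg.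
Qed.

Lemma commuteJ x y g : commute (x ^ g) (y ^ g) <-> commute x y.
Proof.
rewrite /commute -!conjMg; split=> [/conjg_inj //|-> //].
Qed.

Lemma conjg_involution x g : x * x = 1 -> x ^ g * x ^ g = 1.
Proof. by move=> e; rewrite -conjMg e conj1g. Qed.

(* The last field is the universal property of the presentation, in the form of
   actions on arbitrary sets. *)
Record racg (H S : set G) : Prop := Racg {
  racg_gen : forall g, H g <-> exists2 l, word_on S l & wprod l = g;
  racg_sq : forall s, S s -> s * s = 1;
  racg_univ : forall (T : Type) (f : G -> T -> T),
    (forall s, S s -> involutive (f s)) ->
    (forall s t, S s -> S t -> s <> t -> commute s t ->
       forall x : T, f s (f t x) = f t (f s x)) ->
    forall l l' (x : T), word_on S l -> word_on S l' -> wprod l = wprod l' ->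
      foldr f x l = foldr f x l'
}.

Lemma word_on_lift S l : word_on S l ->
  exists2 w : word S, map (fun a => val a.1) w = l & word_eval (fun s : S => val s) w = wprod l.
Proof.
elim: l => [|x l IH]; first by exists [::] => //; rewrite /word_eval big_nil.
move=> /word_on_cons[Sx /IH[w ew ev]].
exists ((exist _ x (mem_set Sx), false) :: w) => /=; first by rewrite ew.
by rewrite /word_eval big_cons /= -/(word_eval _ w) ev.
Qed.

(** The relation [E] of the presentation need not be all of commutation, but letters related by [E]
    commute; so an action that respects commutation respects every relator. *)
Lemma coxeter_basis_racg H S : coxeter_basis H S -> racg H S.
Proof.
case=> E [rH pr].
have sq s : S s -> s * s = 1.
  move=> Ss; have [_] := pr [:: (exist _ s (mem_set Ss), false); (exist _ s (mem_set Ss), false)].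
  rewrite /word_eval !big_cons big_nil /= mulg1; apply.
  exact: (word_eq_relator [::] [::] (coxeter_relator_sq _ _)).
have Sval (s : S) : S (val s) by apply: set_mem; apply: valP.
have evalE w : word_eval (fun s : S => val s) w = wprod (map (fun a => val a.1) w).
  elim: w => [|[s e] w IH]; first by rewrite /word_eval big_nil.
  rewrite /word_eval big_cons /= -/(word_eval _ w) IH; congr (_ * _).
  by case: e => //=; apply: mulg1_eq; apply: sq; apply: Sval.
have Ecomm (s t : S) : s <> t -> E s t -> commute (val s) (val t).
  move=> st Est; have [_] := pr [:: (s, false); (t, false); (s, false); (t, false)].
  rewrite evalE /= mulg1 => h.
  have {h} : val s * (val t * (val s * val t)) = 1.
    by apply: h; apply: (word_eq_relator [::] [::] (coxeter_relator_comm st Est)).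
  rewrite mulgA => /mulg1_eq e; rewrite /commute -[LHS]e.
  by rewrite invgM; congr (_ * _); apply: mulg1_eq; apply: sq; apply: Sval.
split=> //.
  move=> g; split.
    rewrite -rH => -[w _ <-]; rewrite evalE.
    by exists (map (fun a => val a.1) w) => // x /mapP[a _ ->].
  case=> l /word_on_lift[w _ ew] <-; rewrite -rH -ew.
  by exists w.
move=> T f finv fcomm.
have fK (s : S) : involutive (f (val s)) := finv _ (Sval s).
pose act (z : T) (w : word S) := foldr (fun a => f (val a.1)) z w.
have actE z w : act z w = foldr f z (map (fun a => val a.1) w).
  by elim: w => //= a w ->.
have act_cat z w w' : act z (w ++ w') = act (act z w') w by rewrite /act foldr_cat.
have acteq w w' : word_eq (coxeter_relator E) w w' -> forall z, act z w = act z w'.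
  elim=> {w w'} //.
  - by move=> w1 w2 w3 _ h1 _ h2 z; rewrite h1 h2.
  - move=> u v s e z; rewrite !act_cat; congr (act _ u) => /=.
    exact: fK.
  - move=> u v r hr z; rewrite !act_cat; congr (act _ u).
    case: r / hr => [s|s t st Est] /=; first exact: fK.
    rewrite (fcomm _ _ (Sval t) (Sval s)); first by rewrite !fK.
      by move=> /val_inj ts; apply: st.
    by apply: commute_sym; apply: Ecomm.
have act1 l z : word_on S l -> wprod l = 1 -> foldr f z l = z.
  move=> /word_on_lift[w <- ew] e1; rewrite -actE; apply: (acteq w [::]).
  by apply/pr; rewrite ew.
move=> l l' z Sl Sl' e.
have frev : foldr f (foldr f z l') (rev l') = z.
  rewrite -foldr_cat; apply: act1.
    by apply/word_on_cat; split=> //; apply: word_on_rev.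
  by rewrite wprod_cat (wprod_rev sq Sl') mulVg.
rewrite -{1}frev -foldr_cat; apply: act1.
  by apply/word_on_cat; split=> //; apply: word_on_rev.
by rewrite wprod_cat (wprod_rev sq Sl') e mulgV.
Qed.

End Words.

(** * Walls *)

Section Walls.
Variable G : groupType.
Implicit Types (x y r s t u g h : G) (l p q : seq G).

(** The reflection cocycle: prefixing the letter [x] to a path toggles the wall of [x] and moves the
    walls crossed by the rest by conjugation. These maps are involutions and commute for commuting
    letters, so by [racg_univ] the parity of crossings depends only on the endpoint. *)
Definition cross x (phi : G -> bool) : G -> bool :=
  fun r => (r == x) (+) phi (r ^ x).

Definition wside l : G -> bool := foldr cross (fun=> false) l.

Definition shortest (S : set G) g l : Prop :=
  [/\ word_on S l, wprod l = g
    & forall l', word_on S l' -> wprod l' = g -> (size l <= size l')%N].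

(** The default [[::]] is taken only for [g] outside the subgroup generated by [S]. *)
Definition rword (S : set G) g : seq G := xget [::] [set l | shortest S g l].

Definition len (S : set G) g : nat := size (rword S g).

(* Whether the wall of the reflection r separates 1 from g. *)
Definition side (S : set G) r g : bool := wside (rword S g) r.

Definition reflection (H S : set G) r : Prop :=
  exists2 u, H u & S (r ^ u).

Lemma wside_cat l l' r : wside (l ++ l') r = wside l r (+) wside l' (r ^ wprod l).
Proof.
elim: l r => [|x l IH] r /=; first by rewrite conjg1.
by rewrite /cross /= IH conjgM addbA.
Qed.

(** An odd number of crossings has a first one, and the path is cut there: [z] is the crossing
    letter and [p] has not yet met the wall. *)
Lemma wside_split l r : wside l r ->
  exists p z q, [/\ l = p ++ z :: q, r ^ wprod p = z & ~~ wside p r].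
Proof.
elim: l r => [|x l IH] r //=; rewrite /cross.
case: eqP => [->|/eqP rx] /=.
  by move=> _; exists [::], x, l; split=> //=; rewrite conjg1.
move=> /IH[p [z [q [-> e n]]]]; exists (x :: p), z, q; split=> //=.
  by rewrite conjgM.
by rewrite /cross (negPf rx).
Qed.

Section Basis.
Variables H S : set G.
Hypothesis HS : racg H S.

Lemma racg_inv s : S s -> s^-1 = s.
Proof. by move=> Ss; apply/mulg1_eq/(racg_sq HS). Qed.

Lemma racg_word l : word_on S l -> H (wprod l).
Proof. by move=> Sl; apply/(racg_gen HS); exists l. Qed.

Lemma racg1 : H 1.
Proof. exact: (racg_word (@word_on_nil _ S)). Qed.

Lemma racgM g h : H g -> H h -> H (g * h).
Proof.
move=> /(racg_gen HS)[l Sl <-] /(racg_gen HS)[l' Sl' <-].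
by rewrite -wprod_cat; apply: racg_word; apply/word_on_cat.
Qed.

Lemma racgV g : H g -> H g^-1.
Proof.
move=> /(racg_gen HS)[l Sl <-]; rewrite -(wprod_rev (racg_sq HS) Sl).
by apply: racg_word; apply: word_on_rev.
Qed.

Lemma racgJ g h : H g -> H h -> H (g ^ h).
Proof. by move=> Hg Hh; rewrite conjgE; apply: racgM; [apply: racgV | apply: racgM]. Qed.

Lemma racg_sub s : S s -> H s.
Proof.
move=> Ss; rewrite -[s]mulg1; apply: (@racg_word [:: s]).
by apply/word_on_cons.
Qed.

Lemma reflection_in r : reflection H S r -> H r.
Proof.
case=> u Hu Sru; rewrite -(conjgK u r); apply: racgJ; first exact: racg_sub.
exact: racgV.
Qed.

Lemma reflection_sq r : reflection H S r -> r * r = 1.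
Proof.
case=> u Hu Sru; rewrite -(conjgK u r); apply: conjg_involution.
exact: racg_sq HS _ Sru.
Qed.

Lemma reflection_gen s : S s -> reflection H S s.
Proof. by move=> Ss; exists 1; rewrite ?conjg1 //; apply: racg1. Qed.

Lemma reflectionJ r g : H g -> reflection H S r -> reflection H S (r ^ g).
Proof.
move=> Hg [u Hu Sr]; exists (g^-1 * u); first by apply: racgM => //; apply: racgV.
by rewrite conjgM conjgK.
Qed.

Lemma rwordP g : H g -> shortest S g (rword S g).
Proof.
move=> /(racg_gen HS)[l0 Sl0 el0]; apply: (@xgetPex _ [::] [set l | shortest S g l]).
pose P n := `[< exists l, [/\ word_on S l, wprod l = g & size l = n] >].
have exP : exists n, P n by exists (size l0); apply/asboolP; exists l0.
case: (ex_minnP exP) => n /asboolP[l [Sl el sl]] minn; exists l; split=> // l' Sl' el'.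
by rewrite sl; apply: minn; apply/asboolP; exists l'.
Qed.

Lemma wside_eq l l' : word_on S l -> word_on S l' -> wprod l = wprod l' ->
  wside l =1 wside l'.
Proof.
move=> Sl Sl' e r; congr (_ r); apply: (racg_univ HS) => //.
- move=> s Ss phi; apply/funext => x; rewrite /cross -conjgM (racg_sq HS) // conjg1.
  have -> : (x ^ s == s) = (x == s).
    by rewrite -[in RHS](inj_eq (@conjg_inj _ s)); have /commuteE -> := commute_refl s.
  by rewrite addbA addbb.
- move=> s t Ss St st cst phi; apply/funext => x; rewrite /cross.
  have -> : (x ^ s == t) = (x == t).
    by rewrite -[in RHS](inj_eq (@conjg_inj _ s)); move/commuteE: (commute_sym cst) => ->.
  have -> : (x ^ t == s) = (x == s).
    by rewrite -[in RHS](inj_eq (@conjg_inj _ t)); move/commuteE: cst => ->.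
  by rewrite -!conjgM cst addbCA.
Qed.

Lemma side_word l r : word_on S l -> side S r (wprod l) = wside l r.
Proof.
move=> Sl; have [Sr er _] := rwordP (racg_word Sl).
exact: wside_eq.
Qed.

Lemma sideM r g h : H g -> H h -> side S r (g * h) = side S r g (+) side S (r ^ g) h.
Proof.
move=> Hg Hh; have [Sg eg _] := rwordP Hg; have [Sh eh _] := rwordP Hh.
rewrite -{1}eg -{1}eh -wprod_cat side_word; last by apply/word_on_cat.
by rewrite wside_cat eg.
Qed.

Lemma side_gen r s : S s -> side S r s = (r == s).
Proof.
move=> Ss; rewrite -{1}[s]mulg1 (@side_word [:: s]) /= ?/cross ?addbF //.
by apply/word_on_cons.
Qed.

Lemma side1 r : side S r 1 = false.
Proof. exact: (side_word r (@word_on_nil _ S)). Qed.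

Lemma sideV r g : H g -> side S (r ^ g) g^-1 = side S r g.
Proof.
move=> Hg; have := side1 r; rewrite -(mulgV g) sideM //; last exact: racgV.
by case: (side S r g); case: side.
Qed.

Lemma side_reflect r : reflection H S r -> side S r r.
Proof.
case=> u Hu Sru; have Hu' := racgV Hu; have Hs := racg_sub Sru.
have e : r = u * (r ^ u * u^-1) by rewrite conjgE !mulgA mulgK mulgV mul1g.
rewrite {2}e (sideM _ Hu (racgM Hs Hu')) (sideM _ Hs Hu').
have -> : (r ^ u) ^ (r ^ u) = r ^ u by apply/commuteE.
by rewrite sideV // (side_gen _ Sru) eqxx; case: side.
Qed.

Lemma side_reflM r g : reflection H S r -> H g -> side S r (r * g) = ~~ side S r g.
Proof.
move=> rr Hg; rewrite sideM //; last exact: reflection_in.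
by rewrite side_reflect //; have -> : r ^ r = r by apply/commuteE.
Qed.

Lemma side_mulr_gen r g s : H g -> S s -> side S r (g * s) = side S r g (+) (r ^ g == s).
Proof. by move=> Hg Ss; rewrite (sideM _ Hg (racg_sub Ss)) (side_gen _ Ss). Qed.

(** With [t ^ u] a letter, [t * u = u * t ^ u] gives two computations of [side S r (t * u)]; passing
    from [u] to [t * u] crosses the wall [t] alone. *)
Lemma side_commute r t : reflection H S r -> reflection H S t -> r <> t ->
  commute r t -> side S r t = false.
Proof.
move=> rr rt neq c; have Ht := reflection_in rt; case: (rt) => u Hu Su.
have e : t * u = u * t ^ u by rewrite conjgE mulgA mulgV mul1g.
have := sideM r Ht Hu; rewrite e side_mulr_gen // (inj_eq (@conjg_inj _ u)).
have /commuteE -> := c; have -> : (r == t) = false by apply/eqP.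
by case: (side S r u); case: side.
Qed.

Lemma side_commuteM r t g : reflection H S r -> reflection H S t -> r <> t ->
  commute r t -> H g -> side S r (t * g) = side S r g.
Proof.
move=> rr rt neq c Hg; rewrite (sideM _ (reflection_in rt) Hg) side_commute //.
by have /commuteE -> := c.
Qed.

Lemma len_word l : word_on S l -> (len S (wprod l) <= size l)%N.
Proof. by move=> Sl; have [_ _] := rwordP (racg_word Sl); apply. Qed.

(** Deleting the letter of a shortest word at which the wall [r] is first crossed leaves a word for
    [r * g]; the deleted letter is a conjugate of [r]. *)
Lemma exchange r g : H g -> side S r g -> reflection H S r /\ (len S (r * g) < len S g)%N.
Proof.
move=> Hg sr; have [Sg eg _] := rwordP Hg.
have [p [z [q [e ez _]]]] := wside_split sr.
move: Sg eg; rewrite /len e => /word_on_cat[Sp /word_on_cons[Sz Sq]].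
rewrite wprod_cat /= => eg; split.
  by exists (wprod p); [apply: racg_word | rewrite ez].
have -> : r * g = wprod (p ++ q).
  rewrite -eg wprod_cat !mulgA; congr (_ * _).
  have -> : r * wprod p = wprod p * z by rewrite -ez conjgE !mulgA mulgV mul1g.
  by rewrite -mulgA (racg_sq HS) ?mulg1.
apply: leq_ltn_trans (len_word _) _; first by apply/word_on_cat.
by rewrite !size_cat /= addnS.
Qed.

Lemma len_eq0 g : H g -> len S g = 0 -> g = 1.
Proof. by move=> Hg /size0nil e; have [_ <-] := rwordP Hg; rewrite e. Qed.

Lemma descent g : H g -> g <> 1 -> exists2 s, S s & side S s g.
Proof.
move=> Hg g1; have [Sg eg mg] := rwordP Hg.
case e : (rword S g) Sg eg mg => [|s l]; first by move=> _ /esym.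
move=> /word_on_cons[Ss Sl] /= eg _; exists s => //.
have Hs := racg_sub Ss; have Hl := racg_word Sl.
apply/negPn/negP => ns.
have /exchange[] // : side S s (wprod l).
  by move: ns; rewrite -eg (side_reflM (reflection_gen Ss)) // negbK.
rewrite eg => _; rewrite {1}/len e /= => /leq_trans/(_ (len_word Sl)).
by rewrite ltnNge leqnSn.
Qed.

Lemma lenV_le g : H g -> (len S g^-1 <= len S g)%N.
Proof.
move=> Hg; have [Sg eg _] := rwordP Hg.
rewrite -{1}eg -(wprod_rev (racg_sq HS) Sg).
by apply: leq_trans (len_word (word_on_rev Sg)) _; rewrite size_rev.
Qed.

Lemma lenV g : H g -> len S g^-1 = len S g.
Proof.
move=> Hg; apply/eqP; rewrite eqn_leq lenV_le //=.
by rewrite -{1}[g]invgK lenV_le //; apply: racgV.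
Qed.

Lemma lenM_le g h : H g -> H h -> (len S (g * h) <= len S g + len S h)%N.
Proof.
move=> Hg Hh; have [Sg eg _] := rwordP Hg; have [Sh eh _] := rwordP Hh.
rewrite -{1}eg -{1}eh -wprod_cat; apply: leq_trans (len_word _) _.
  by apply/word_on_cat.
by rewrite size_cat.
Qed.

(* A geodesic crosses each wall at most once. *)
Lemma shortest_cross g p q r : shortest S g (p ++ q) ->
  wside p r -> wside q (r ^ wprod p) = false.
Proof.
move=> [/word_on_cat[Sp Sq] eg mg] sp; apply/negP => sq.
have Hp := racg_word Sp; have Hq := racg_word Sq.
have [rr lp] : reflection H S r /\ (len S (r * wprod p) < len S (wprod p))%N.
  by apply: exchange; rewrite ?side_word.
have [_ lq] : reflection H S (r ^ wprod p) /\
    (len S (r ^ wprod p * wprod q) < len S (wprod q))%N.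
  by apply: exchange; rewrite ?side_word.
have Hr := reflection_in rr.
have Hg : H g by rewrite -eg wprod_cat; apply: racgM.
have [Sg eg' _] := rwordP Hg.
have := mg _ Sg eg'; rewrite leqNgt => /negP; apply.
have e : g = (r * wprod p) * (r ^ wprod p * wprod q).
  rewrite -eg wprod_cat conjgE !mulgA; congr (_ * _).
  by rewrite -[r * _ * _]mulgA mulgV mulg1 (reflection_sq rr) mul1g.
rewrite -/(len S g) {1}e size_cat.
apply: leq_ltn_trans (lenM_le _ _) _; [exact: racgM | by apply: racgM => //; apply: racgJ |].
apply: leq_trans (_ : _ <= len S (wprod p) + len S (wprod q))%N _.
  by rewrite -addnS leq_add // ltnW.
by apply: leq_add; apply: len_word.
Qed.

(** Every relator contains each letter an even number of times, so [s] can act on [bool] by negation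
    and all other letters trivially. *)
Lemma parity s l l' : S s -> word_on S l -> word_on S l' -> wprod l = wprod l' ->
  odd (count_mem s l) = odd (count_mem s l').
Proof.
move=> Ss Sl Sl' e.
pose f x (b : bool) := (x == s) (+) b.
have fE w : foldr f false w = odd (count_mem s w).
  by elim: w => //= x w ->; rewrite oddD /f; case: (x == s).
rewrite -!fE; apply: (racg_univ HS) => //.
  by move=> x Sx b; rewrite /f addbA addbb.
by move=> x y _ _ _ _ b; rewrite /f addbCA.
Qed.

Lemma gen_neq1 s : S s -> s <> 1.
Proof.
move=> Ss e; have Sw : word_on S [:: s] by apply/word_on_cons.
by have := parity Ss Sw (@word_on_nil _ S); rewrite /= eqxx e mulg1 => /(_ erefl).
Qed.

(** In a word for [g^-1 s g] built from a word of [g] and its reverse, [s] occurs an odd number of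
    times. *)
Lemma gen_conj s t g : S s -> S t -> H g -> s ^ g = t -> s = t.
Proof.
move=> Ss St Hg e; have [Sg eg _] := rwordP Hg.
have Sl : word_on S (rev (rword S g) ++ s :: rword S g).
  by apply/word_on_cat; split; [apply: word_on_rev | apply/word_on_cons].
have Sr : word_on S [:: t] by apply/word_on_cons.
have := parity Ss Sl Sr; rewrite !wprod_cat (wprod_rev (racg_sq HS)) //= eg mulg1.
rewrite -e => /(_ erefl); rewrite count_cat count_rev /= eqxx addnCA oddD.
by rewrite addnn odd_double addn0 /= oddb => /esym/eqP.
Qed.

Lemma span_gen (P : set G) l s : P `<=` S -> word_on P l -> S s -> wprod l = s -> P s.
Proof.
move=> PS Pl Ss e; have Sl : word_on S l by move=> x /Pl/PS.
have Sr : word_on S [:: s] by apply/word_on_cons.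
have := parity Ss Sl Sr; rewrite /= mulg1 eqxx => /(_ e) /= c.
by apply/Pl; rewrite -has_pred1 has_count; case: (count_mem s l) c.
Qed.

(** The universal property is applied to left multiplication by the elements [phi s] on [K];
    multiplicativity is claimed on [H] only. *)
Lemma racg_hom (K : groupType) (phi : G -> K) :
  (forall s, S s -> phi s * phi s = 1) ->
  (forall s t, S s -> S t -> s <> t -> commute s t -> commute (phi s) (phi t)) ->
  exists F : G -> K, [/\ {in S, F =1 phi}, forall g h, H g -> H h -> F (g * h) = F g * F h
    & F 1 = 1].
Proof.
move=> sq comm; pose f x (k : K) := phi x * k.
have fM w k : foldr f k w = foldr f 1 w * k.
  by elim: w => [|x w IH] /=; rewrite ?mul1g // IH /f mulgA.
have univ l l' : word_on S l -> word_on S l' -> wprod l = wprod l' ->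
    foldr f 1 l = foldr f 1 l'.
  move=> Sl Sl' e; apply: (racg_univ HS) => //.
    by move=> s Ss k; rewrite /f mulgA sq // mul1g.
  by move=> s t Ss St st c k; rewrite /f !mulgA comm.
pose F g := foldr f 1 (rword S g).
have FE l : word_on S l -> F (wprod l) = foldr f 1 l.
  by move=> Sl; have [Sr er _] := rwordP (racg_word Sl); apply: univ.
exists F; split.
- move=> s /set_mem Ss; have Sw : word_on S [:: s] by apply/word_on_cons.
  by rewrite -[s in LHS]mulg1 (FE _ Sw) /= /f mulg1.
- move=> g h Hg Hh; have [Sg eg _] := rwordP Hg; have [Sh eh _] := rwordP Hh.
  rewrite -{1}eg -{1}eh -wprod_cat FE; last by apply/word_on_cat.
  by rewrite foldr_cat fM.
- exact: (FE _ (@word_on_nil _ S)).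
Qed.

End Basis.
End Walls.

(** * Descents and half-spaces *)

Section Descents.
Variable G : groupType.
Implicit Types (x y z r s t u g h : G) (l p q : seq G).
Variables H S : set G.
Hypothesis HS : racg H S.

(** * Infinite dihedral subgroups generated by two letters *)

Definition alternating l : bool := sorted [rel x y | x != y] l.

Lemma alternating_word s t l : s * s = 1 -> t * t = 1 -> word_on [set s; t] l ->
  exists l', [/\ word_on [set s; t] l', alternating l' & wprod l' = wprod l].
Proof.
move=> s2 t2; elim: l => [|x l IH] Pl; first by exists [::].
have [Px /IH[m [Pm am em]]] := (word_on_cons _ _ _).1 Pl.
case: m Pm am em => [|y m] Pm am em.
  by exists [:: x]; split=> //=; [apply/word_on_cons | rewrite -em].
have [eq_xy|neq_xy] := eqVneq x y.
  exists m; split; first by case/word_on_cons: Pm.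
    exact: path_sorted am.
  by rewrite /= -em /= -eq_xy mulgA; case: Px => ->; rewrite ?s2 ?t2 mul1g.
exists [:: x, y & m]; split; [by apply/word_on_cons | by rewrite /= neq_xy | by rewrite /= -em].
Qed.

Section Dihedral.
Variables s t : G.
Hypotheses (Ss : S s) (St : S t) (nst : ~ commute s t).

(** The infinite dihedral group acting on the integers: [s] and [t] are the reflections in 1/2 and
    -1/2, all other letters act trivially. The base point 0 lies between the two mirrors, so the
    sign of its image reveals the first letter of an alternating word. *)
Let f x (n : Z) : Z := (if x == s then 1 - n else if x == t then -1 - n else n)%Z.

Let st : (t == s) = false.
Proof. by apply/eqP => e; apply: nst; rewrite e. Qed.

Let st_sub : [set s; t] `<=` S.
Proof. by move=> x [->|->]. Qed.

Lemma dihedral_univ l l' : word_on [set s; t] l -> word_on [set s; t] l' ->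
  wprod l = wprod l' -> foldr f 0%Z l = foldr f 0%Z l'.
Proof.
move=> Pl Pl' e; apply: (racg_univ HS) => //; last 2 first.
- by move=> x /Pl/st_sub.
- by move=> x /Pl'/st_sub.
- by move=> x Sx n; rewrite /f; case: eqP => _; [|case: eqP => _]; lia.
move=> x y Sx Sy neq c n; rewrite /f.
have nts : ~ commute t s by move/commute_sym.
by case: (eqVneq x s) => [ex|_]; case: (eqVneq y s) => [ey|_];
   rewrite ?ex ?ey in neq c *; try lia; case: (eqVneq y t) => [ey'|_];
   rewrite ?ey' in neq c *; try lia; case: (eqVneq x t) => [ex'|_];
   rewrite ?ex' in neq c *; try lia.
Qed.

Lemma alternating_sign x l : word_on [set s; t] (x :: l) -> alternating (x :: l) ->
  (x = s -> 0 < foldr f 0 (x :: l))%Z /\ (x = t -> foldr f 0 (x :: l) < 0)%Z.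
Proof.
elim: l x => [|y l IH] x Pl al.
  by split=> -> /=; rewrite /f ?eqxx ?st; lia.
have [Px Pyl] := (word_on_cons _ _ _).1 Pl.
have /andP[xy /(IH _ Pyl)[hs ht]] : (x != y) && alternating (y :: l) by [].
have [Py _] := (word_on_cons _ _ _).1 Pyl.
have fs n : f s n = (1 - n)%Z by rewrite /f eqxx.
have ft n : f t n = (-1 - n)%Z by rewrite /f st eqxx.
have -> : foldr f 0%Z [:: x, y & l] = f x (foldr f 0%Z (y :: l)) by [].
move: (foldr f 0%Z (y :: l)) hs ht => n hs ht.
split=> e; subst x; rewrite ?fs ?ft.
  case: Py => ey; first by rewrite ey eqxx in xy.
  by move: (ht ey); lia.
case: Py => ey; last by rewrite ey eqxx in xy.
by move: (hs ey); lia.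
Qed.

(** A crossing of the wall [y] would give [y x p = x p z], where both sides are alternating words;
    they begin with different letters, so they move 0 to integers of opposite signs. *)
Lemma alternating_not_conj x y l : word_on [set s; t] (x :: l) -> alternating (x :: l) ->
  [set s; t] y -> y != x -> wside (x :: l) y = false.
Proof.
move=> Pl al Py yx; apply/negP => /wside_split[p [z [q [e ez _]]]].
case: p e ez => [|x' p] /= [e1 e2]; first by rewrite conjg1 => ey; rewrite ey e1 eqxx in yx.
subst x' => /esym ez.
have Pyp : word_on [set s; t] (y :: x :: p).
  by move=> u; rewrite inE => /orP[/eqP->//|up]; apply: Pl; rewrite e2 -cat_cons mem_cat up.
have Ppz : word_on [set s; t] (x :: rcons p z).
  move=> u up; apply: Pl; rewrite e2 -cat_cons mem_cat.
  move: up; rewrite -rcons_cons mem_rcons in_cons [u \in z :: q]in_cons.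
  by case/orP => ->; rewrite ?orbT.
have apz : alternating (x :: rcons p z).
  by move: al; rewrite /alternating /= e2 -cat_rcons cat_path => /andP[].
have ayp : alternating (y :: x :: p).
  by move: apz; rewrite /alternating /= yx rcons_path => /andP[].
have eprod : wprod (y :: x :: p) = wprod (x :: rcons p z).
  by rewrite -rcons_cons -cats1 wprod_cat /= mulg1 ez -conjgC.
have := dihedral_univ Pyp Ppz eprod.
have [h1 h2] := alternating_sign Pyp ayp; have [h3 h4] := alternating_sign Ppz apz.
have [Px _] := (word_on_cons _ _ _).1 Pl.
case: Px Py => ex [] ey; do ?by rewrite ex ey eqxx in yx.
  by move: (h2 ey) (h3 ex); lia.
by move: (h1 ey) (h4 ex); lia.
Qed.

Lemma dihedral_side l : word_on [set s; t] l -> wside l s -> wside l t = false.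
Proof.
move=> Pl.
have [m [Pm am em]] := alternating_word (racg_sq HS Ss) (racg_sq HS St) Pl.
have Sl : word_on S l by move=> x /Pl/st_sub.
have Sm : word_on S m by move=> x /Pm/st_sub.
have sE r : wside l r = wside m r by apply: (wside_eq HS).
rewrite !{}sE; case: m Pm am {em Sm} => [//|x m] Pm am.
have [Px _] := (word_on_cons _ _ _).1 Pm.
case: Px => ex; have {}ex : x = _ := ex; subst x.
  by move=> _; apply: alternating_not_conj Pm am _ _; [right | rewrite st].
by rewrite (alternating_not_conj Pm am _ _) //; [left | rewrite eq_sym st].
Qed.

(* The shortest element of the coset <s,t> g lies on the positive side of every
   wall of the dihedral group <s,t>, which reduces the claim to that group. *)
Lemma two_descents g : H g -> side S s g -> side S t g = false.
Proof.
move=> Hg.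
pose P n := `[< exists2 d, word_on [set s; t] d & len S (wprod d * g) = n >].
have exP : exists n, P n.
  by exists (len S g); apply/asboolP; exists [::]; rewrite //= mul1g.
case: (ex_minnP exP) => n /asboolP[d Pd ed] minn.
have Sd : word_on S d by move=> x /Pd/st_sub.
have Hd := racg_word HS Sd.
set w := wprod d * g in ed; have Hw : H w by apply: (racgM HS).
have Pv := word_on_rev Pd; have Sv := word_on_rev Sd.
have Hv := racg_word HS Sv.
have eg : g = wprod (rev d) * w by rewrite (wprod_rev (racg_sq HS) Sd) /w mulKg.
have sideE r : [set s; t] r -> side S r g = wside (rev d) r.
  move=> Pr; rewrite eg (sideM HS) // (side_word HS) //.
  case sw : (side S (r ^ wprod (rev d)) w); last by rewrite addbF.
  have [_] := exchange HS Hw sw; rewrite ed ltnNge => /negP[]; apply: minn.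
  apply/asboolP; exists (d ++ r :: rev d ++ d).
    by apply/word_on_cat; split=> //; apply/word_on_cons; split=> //; apply/word_on_cat.
  rewrite !wprod_cat /= wprod_cat (wprod_rev (racg_sq HS) Sd) /w.
  by rewrite conjgE invgK !mulgA.
rewrite !sideE; [exact: dihedral_side | by right | by left].
Qed.

End Dihedral.

(** * Descents and centralizers *)

Lemma descent_commute g s t : H g -> S s -> S t -> side S s g -> side S t g -> commute s t.
Proof.
move=> Hg Ss St ss stt; apply: contrapT => nst.
by rewrite (two_descents Ss St nst Hg ss) in stt.
Qed.

(** If [s] is not a descent of [g], it is one of [s * g = g * s]. There [t] is still a descent,
    because appending [s] to [g] crosses the wall [t] only if [t] is conjugate to [s]. Two descents
    of one element commute. *)
Lemma descent_centralizer g s t : H g -> S s -> S t -> commute g s -> side S t g ->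
  commute t s.
Proof.
move=> Hg Ss St c tg.
have [->|/eqP ts] := eqVneq t s; first exact: commute_refl.
have Hs := racg_sub HS Ss.
case sg : (side S s g); first exact: descent_commute tg sg.
apply: (descent_commute (racgM HS Hs Hg)) => //.
  rewrite -c (side_mulr_gen HS) // tg.
  have -> // : (t ^ g == s) = false by apply/eqP => /(gen_conj HS St Ss Hg).
by rewrite (side_reflM HS) ?sg //; apply: reflection_gen.
Qed.

Lemma len_mul_descent g s : H g -> S s -> side S s g -> (len S (s * g) < len S g)%N.
Proof. by move=> Hg Ss /(exchange HS Hg)[]. Qed.

(* The chambers adjacent to the wall t are joined by crossing walls that commute with t. *)
Lemma side_centralizer r t u k : reflection H S r -> ~ commute r t -> H u -> S (t ^ u) ->
  H k -> commute k (t ^ u) -> side S r (u * k) = side S r u.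
Proof.
move=> rr nc; move: {2}(len S k) (leqnn (len S k)) => n.
elim: n u k => [|n IH] u k; rewrite ?leqn0 => hn Hu Stu Hk ck.
  by move/eqP: hn => /(len_eq0 HS Hk) ->; rewrite mulg1.
have [->|/eqP k1] := eqVneq k 1; first by rewrite mulg1.
have [x Sx xk] := descent HS Hk k1.
have cx := descent_centralizer Hk Stu Sx ck xk.
have Hx := racg_sub HS Sx.
have e : t ^ (u * x) = t ^ u by rewrite conjgM; apply/commuteE/commute_sym.
have -> : u * k = (u * x) * (x * k).
  by rewrite -!mulgA [x * (x * k)]mulgA (racg_sq HS) // mul1g.
rewrite IH ?e //.
- rewrite (side_mulr_gen HS) //.
  case: eqP => [ex|]; last by rewrite addbF.
  by case: nc; apply/(commuteJ _ _ u); rewrite ex.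
- by rewrite -ltnS; apply: leq_trans hn; apply: len_mul_descent.
- exact: (racgM HS).
- exact: (racgM HS).
- by apply/commute_sym/commuteM; apply/commute_sym.
Qed.

(** Nesting of half-spaces: one side of [r] is contained in one side of [t]. *)
Definition empty_quadrant r a t b : Prop :=
  forall g, H g -> ~ (side S r g = a /\ side S t g = b).

Lemma empty_quadrant_sym r a t b : empty_quadrant r a t b -> empty_quadrant t b r a.
Proof. by move=> h g Hg [? ?]; apply: (h g Hg). Qed.

Lemma empty_quadrantN r a t b g : empty_quadrant r a t b -> H g ->
  side S r g = a -> side S t g = ~~ b.
Proof. by move=> h Hg e; have := h g Hg; rewrite e; case: (side S t g); case: (b) => // -[]. Qed.

(* A geodesic inside a half-space of r meets no chamber adjacent to t, if these all lie in
   the other half-space. *)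
Lemma noncommuting_quadrant r t : reflection H S r -> reflection H S t -> ~ commute r t ->
  exists a b, empty_quadrant r a t b.
Proof.
move=> rr [u Hu Stu] nc; set a := side S r u.
have adj g : H g -> S (t ^ g) -> side S r g = a.
  move=> Hg Sg; have Huv := racgV HS Hu; have Hk := racgM HS Huv Hg.
  rewrite -[g](mulVKg u) (side_centralizer rr nc Hu Stu Hk) //.
  apply/commute_sym/commuteE; rewrite -conjgM mulVKg; apply/esym.
  by apply: (gen_conj HS Stu Sg Hk); rewrite -conjgM mulVKg.
apply: contrapT => hn.
have wit b : exists g, [/\ H g, side S r g = ~~ a & side S t g = b].
  apply: contrapT => h; apply: hn; exists (~~ a), b => g Hg [e1 e2].
  by apply: h; exists g.
have [g1 [Hg1 r1 t1]] := wit false; have [g2 [Hg2 r2 t2]] := wit true.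
have Hk : H (g1^-1 * g2) by apply: (racgM HS) => //; apply: (racgV HS).
have sk x : side S x g2 = side S x g1 (+) side S (x ^ g1) (g1^-1 * g2).
  by rewrite -(sideM HS) // mulVKg.
have sl := rwordP HS Hk; have [Sl el _] := sl.
have /wside_split[p [z [q [e ez _]]]] : wside (rword S (g1^-1 * g2)) (t ^ g1).
  by have := sk t; rewrite t1 t2 => /esym.
rewrite e in sl Sl; have [Sp Szq] := (word_on_cat _ _ _).1 Sl.
have Hp := racg_word HS Sp.
have sp : wside p (r ^ g1).
  have : side S r (g1 * wprod p) = a.
    apply: adj; first exact: (racgM HS).
    by rewrite conjgM ez; case/word_on_cons: Szq.
  by rewrite (sideM HS) // r1 (side_word HS) //; case: (a); case: wside.
have := shortest_cross HS sl sp.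
have : wside (rword S (g1^-1 * g2)) (r ^ g1) = false.
  by have := sk r; rewrite r1 r2 /side; case: (a); case: wside.
by rewrite e wside_cat sp => /negbFE ->.
Qed.

(** Two empty quadrants with a common side would make a half-space empty; two opposite ones would
    make each wall's side determine the other's. *)
Lemma empty_quadrant_uniq r t a b a' b' : reflection H S r -> reflection H S t -> r <> t ->
  empty_quadrant r a t b -> empty_quadrant r a' t b' -> a = a' /\ b = b'.
Proof.
move=> rr rt neq h h'; have Hr := reflection_in HS rr.
have H1 := racg1 HS.
have ex x c : reflection H S x -> exists2 g, H g & side S x g = c.
  move=> rx; case: c; [exists x; [exact: reflection_in HS _ rx | exact: side_reflect HS _ rx] |].
  by exists 1; rewrite // (side1 HS).
have [eaa|naa] := eqVneq a a'; have [ebb|nbb] := eqVneq b b'; subst; try by [].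
- have [g Hg eg] := ex r a' rr; have := empty_quadrantN h Hg eg.
  by rewrite (empty_quadrantN h' Hg eg) => /negb_inj ebb; rewrite ebb eqxx in nbb.
- have [g Hg eg] := ex t b' rt; have := empty_quadrantN (empty_quadrant_sym h) Hg eg.
  rewrite (empty_quadrantN (empty_quadrant_sym h') Hg eg) => /negb_inj eaa.
  by rewrite eaa eqxx in naa.
(* Crossing the wall t alone changes one side but not the other. *)
have [u Hu Su] := rt; have e : t * u = u * t ^ u by rewrite conjgE mulgA mulgV mul1g.
have Htu : H (t * u) by apply: (racgM HS) => //; apply: reflection_in HS _ rt.
have s1 : side S r (t * u) = side S r u.
  rewrite e (side_mulr_gen HS) // (inj_eq (@conjg_inj _ u)).
  by case: eqP => // _; rewrite addbF.
have s2 : side S t (t * u) = ~~ side S t u by apply: (side_reflM HS).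
move: (h _ Hu) (h _ Htu) (h' _ Hu) (h' _ Htu); rewrite s1 s2.
move: naa nbb; case: (a); case: (a') => //; case: (b); case: (b') => // _ _;
  case: (side S r u); case: (side S t u) => /= h1 h2 h3 h4; exfalso; auto.
Qed.

(** Walls of distinct commuting reflections cross, so some chamber has side [b] of [t] and side [b']
    of [t']. If [a] and [a'] differed, no side of [s] would be left for it. *)
Lemma empty_quadrant_commute s t t' a b a' b' : reflection H S s -> reflection H S t ->
  reflection H S t' -> s <> t -> commute t t' ->
  empty_quadrant s a t b -> empty_quadrant s a' t' b' -> a = a'.
Proof.
move=> rs rt rt' neq c h h'.
have [ett|/eqP tt] := eqVneq t t'.
  by subst t'; have [] := empty_quadrant_uniq rs rt neq h h'.
apply: contrapT => naa.
have H1 := racg1 HS; have Ht := reflection_in HS rt; have Ht' := reflection_in HS rt'.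
have [g Hg [e1 e2]] : exists2 g, H g & side S t g = b /\ side S t' g = b'.
  have [g1 Hg1 eg1] : exists2 g, H g & side S t' g = b'.
    case: (b'); last by exists 1; rewrite // (side1 HS).
    by exists t' => //; exact: side_reflect HS _ rt'.
  have [eb|nb] := eqVneq (side S t g1) b; first by exists g1.
  exists (t * g1); first exact: (racgM HS).
  rewrite (side_reflM HS) // (side_commuteM HS rt' rt _ (commute_sym c)) //.
    by split=> //; move: nb; case: side; case: (b).
  by move=> ett; apply: tt.
have := h _ Hg; have := h' _ Hg; rewrite e1 e2.
by move: naa; case: (a); case: (a'); case: side => // _ h1 h2; auto.
Qed.

End Descents.

(** * Involutions and centralizers *)

Section Involutions.
Variable G : groupType.
Implicit Types (x y z r s t u g h a b c : G) (l p q : seq G).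
Variables H S : set G.
Hypothesis HS : racg H S.

Lemma racg_ind (P : G -> Prop) : P 1 ->
  (forall s g, S s -> H g -> P g -> P (s * g)) -> forall g, H g -> P g.
Proof.
move=> P1 PM g /(racg_gen HS)[l Sl <-]; elim: l Sl => // s l IH /word_on_cons[Ss Sl].
by apply: PM => //; [apply: (racg_word HS) | apply: IH].
Qed.

Lemma racg_hom_eq (K : groupType) (F F' : G -> K) :
  (forall g h, H g -> H h -> F (g * h) = F g * F h) ->
  (forall g h, H g -> H h -> F' (g * h) = F' g * F' h) ->
  F 1 = F' 1 -> (forall s, S s -> F s = F' s) -> forall g, H g -> F g = F' g.
Proof.
move=> FM FM' F1 FS; apply: racg_ind => // s g Ss Hg e.
by have Hs := racg_sub HS Ss; rewrite FM // FM' // FS // e.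
Qed.

Lemma gen_neq_mul s t x : S s -> S t -> S x -> x <> s -> x <> t -> x <> s * t.
Proof.
move=> Ss St Sx /eqP xs /eqP xt e.
have S1 : word_on S [:: x] by apply/word_on_cons.
have S2 : word_on S [:: s; t] by apply/word_on_cons; split=> //; apply/word_on_cons.
have := parity HS Sx S1 S2; rewrite /= !mulg1 => /(_ e).
by rewrite eqxx eq_sym (negPf xs) eq_sym (negPf xt).
Qed.

Lemma len_conj_descent g s : H g -> g * g = 1 -> S s -> side S s g -> ~ commute g s ->
  (len S (g ^ s) < len S g)%N.
Proof.
move=> Hg g2 Ss sg nc; have Hs := racg_sub HS Ss.
have Hgs := racgM HS Hg Hs.
have gs : side S s (g * s).
  rewrite (side_mulr_gen HS) // sg; case: eqP => // e.
  by case: nc; apply/commute_sym/commuteE.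
rewrite conjgE (racg_inv HS Ss).
apply: ltn_trans (len_mul_descent HS Hgs Ss gs) _.
rewrite -(lenV HS Hgs) invgM (racg_inv HS Ss) (mulg1_eq g2).
exact: (len_mul_descent HS Hg Ss sg).
Qed.

(** Conjugation by a descent that does not commute with [g] shortens [g]. Once all descents commute
    with [g], they peel off as pairwise commuting letters; a third one would complete a triangle. *)
Lemma involution_class :
  (forall s t u, S s -> S t -> S u -> s <> t -> t <> u -> s <> u ->
     commute s t -> commute t u -> commute s u -> False) ->
  forall g, H g -> g * g = 1 -> g <> 1 ->
  exists2 u, H u & S (g ^ u) \/
    exists s t, [/\ S s, S t, s <> t, commute s t & g ^ u = s * t].
Proof.
move=> notri g; move: {2}(len S g) (leqnn (len S g)) => n.
elim: n g => [|n IH] g; rewrite ?leqn0 => hn Hg g2 g1.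
  by move/eqP: hn => /(len_eq0 HS Hg).
have [[x [Sx xg nc]]|hcomm] := pselect (exists x, [/\ S x, side S x g & ~ commute g x]).
  have Hx := racg_sub HS Sx; have Hgx := racgJ HS Hg Hx.
  have lt := len_conj_descent Hg g2 Sx xg nc.
  have [||u Hu hu] := IH _ _ Hgx (conjg_involution x g2).
  - by rewrite -ltnS (leq_trans lt).
  - by move/eqP; rewrite conjg_eq1 => /eqP.
  by exists (x * u); [apply: (racgM HS) | rewrite conjgM].
have dcomm x : S x -> side S x g -> commute g x.
  by move=> Sx xg; apply: contrapT => nc; apply: hcomm; exists x.
have [s Ss sg] := descent HS Hg g1.
have Hs := racg_sub HS Ss; have rs := reflection_gen HS Ss; have s2 := racg_sq HS Ss.
have cgs := dcomm _ Ss sg; set h := s * g.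
have eg : g = s * h by rewrite /h mulgA s2 mul1g.
have Hh : H h by apply: (racgM HS).
have chs : commute h s by apply/commute_sym/commuteM => //; apply: commute_sym.
have sh : side S s h = false by rewrite (side_reflM HS) // sg.
have [h1|/eqP h1] := eqVneq h 1.
  by exists 1; [apply: (racg1 HS) | left; rewrite conjg1 eg h1 mulg1].
have [t St th] := descent HS Hh h1.
have Ht := racg_sub HS St; have rt := reflection_gen HS St; have t2 := racg_sq HS St.
have cts := descent_centralizer HS Hh Ss St chs th.
have nts : t <> s by move=> e; rewrite e sh in th.
have tg : side S t g by rewrite eg (side_commuteM HS rt rs nts cts Hh).
have cgt := dcomm _ St tg.
have cht : commute h t by apply/commute_sym/commuteM => //; apply: commute_sym.
set k := t * h; have eh : h = t * k by rewrite /k mulgA t2 mul1g.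
have Hk : H k by apply: (racgM HS).
have tk : side S t k = false by rewrite (side_reflM HS) // th.
have [k1|/eqP k1] := eqVneq k 1.
  exists 1; first exact: (racg1 HS).
  right; exists s, t; split=> //; first by move/esym.
  by rewrite conjg1 eg eh k1 mulg1.
have [x Sx xk] := descent HS Hk k1.
have cxs : commute x s.
  by apply: (descent_centralizer HS Hk) => //; apply/commute_sym/commuteM;
    apply: commute_sym.
have cxt : commute x t.
  by apply: (descent_centralizer HS Hk) => //; apply/commute_sym/commuteM => //;
    apply: commute_sym.
have sk : side S s k = false.
  by rewrite (side_commuteM HS rs rt _ (commute_sym cts) Hh) // => /esym.
case: (notri x t s) => //.
- by move=> e; rewrite e tk in xk.
- by move=> e; rewrite e sk in xk.
Qed.

(** Multiplying [g] by those of [a], [c] that are descents leaves an [h] of which neither is a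
    descent. A descent of [h] would persist in [a c h = h a c], which also has the descents [a] and
    [c]; it would commute with both, against [link]. *)
Lemma pair_centralizer a c g : S a -> S c -> a <> c -> commute a c ->
  (forall u, S u -> commute u a -> commute u c -> u = a \/ u = c) ->
  H g -> commute g (a * c) -> [\/ g = 1, g = a, g = c | g = a * c].
Proof.
move=> Sa Sc ac cac link.
have Ha := racg_sub HS Sa; have Hc := racg_sub HS Sc.
have ra := reflection_gen HS Sa; have rc := reflection_gen HS Sc.
have a2 := racg_sq HS Sa; have c2 := racg_sq HS Sc.
have ca : c <> a by move/esym.
have cca := commute_sym cac.
have Hac := racgM HS Ha Hc.
have core h : H h -> commute h (a * c) -> side S a h = false -> side S c h = false -> h = 1.
  move=> Hh ch ah chh; apply: contrapT => h1; have [t St th] := descent HS Hh h1.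
  have Hch := racgM HS Hc Hh.
  have ta : t <> a by move=> e; rewrite e ah in th.
  have tc : t <> c by move=> e; rewrite e chh in th.
  have a' : side S a (a * (c * h)).
    by rewrite (side_reflM HS) // (side_commuteM HS ra rc ac cac Hh) ah.
  have c' : side S c (a * (c * h)).
    by rewrite (side_commuteM HS rc ra ca cca Hch) (side_reflM HS) // chh.
  have t' : side S t (a * (c * h)).
    rewrite mulgA -ch mulgA (side_mulr_gen HS _ (racgM HS Hh Ha)) // (side_mulr_gen HS) // th.
    case: eqP => [/(gen_conj HS St Sa Hh)//|_] /=.
    by case: eqP => // /(gen_conj HS St Sc (racgM HS Hh Ha)).
  have Hach := racgM HS Ha Hch.
  have [] // := link t St.
  - exact: (descent_commute HS Hach).
  - exact: (descent_commute HS Hach).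
move=> Hg cg.
have cxa : commute (a * c) a by apply/commute_sym/commuteM.
have cxc : commute (a * c) c by apply/commute_sym/commuteM.
have comm x h : commute x (a * c) -> commute h (a * c) -> commute (x * h) (a * c).
  by move=> c1 c3; apply/commute_sym/commuteM; apply: commute_sym.
have mul1 x h : x * x = 1 -> x * h = 1 -> h = x.
  by move=> x2 /mulg1_eq <-; apply: mulg1_eq.
case ag : (side S a g); case cg' : (side S c g).
- have Hcg := racgM HS Hc Hg.
  have /(mul1 _ _ a2) e : a * (c * g) = 1.
    apply: (core); [exact: (racgM HS) | | |].
    + by apply: (comm); [exact: commute_sym | apply: (comm) => //; exact: commute_sym].
    + by rewrite (side_reflM HS) // (side_commuteM HS ra rc ac cac Hg) ag.
    + by rewrite (side_commuteM HS rc ra ca cca Hcg) (side_reflM HS) // cg'.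
  by apply: Or44; rewrite cac -e mulgA c2 mul1g.
- have /(mul1 _ _ a2) e : a * g = 1; last exact: Or42.
  apply: (core); [exact: (racgM HS) | by apply: (comm) => //; exact: commute_sym | |].
    by rewrite (side_reflM HS) // ag.
  by rewrite (side_commuteM HS rc ra ca cca Hg).
- have /(mul1 _ _ c2) e : c * g = 1; last exact: Or43.
  apply: (core); [exact: (racgM HS) | by apply: (comm) => //; exact: commute_sym | |].
    by rewrite (side_commuteM HS ra rc ac cac Hg).
  by rewrite (side_reflM HS) // cg'.
- by apply: Or41; apply: (core).
Qed.

(* If t is the only neighbour of s, then s |-> s t extends to an involutive automorphism,
   which carries the centralizer of s t to that of s. *)
Lemma transvection_centralizer s t y : S s -> S t -> s <> t -> commute s t ->
  (forall x, S x -> x <> s -> commute x s -> x = t) ->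
  (forall g, H g -> commute g s -> [\/ g = 1, g = t, g = s | g = s * t]) ->
  H y -> commute y (s * t) -> [\/ y = 1, y = t, y = s | y = s * t].
Proof.
move=> Ss St st cst link cent Hy cy.
have Hs := racg_sub HS Ss; have Ht := racg_sub HS St.
have s2 := racg_sq HS Ss; have t2 := racg_sq HS St.
pose phi x := if x == s then s * t else x.
have ts : (t == s) = false by apply/eqP => /esym.
have [||F [FS FM F1]] := @racg_hom _ _ _ HS G phi.
- move=> x Sx; rewrite /phi; case: eqP => _; last exact: (racg_sq HS).
  by rewrite {1}cst mulgA -[t * s * s]mulgA s2 mulg1 t2.
- move=> x z Sx Sz xz c; rewrite /phi; case: eqP => [ex|nx]; case: eqP => [ez|nz] //.
  + subst x; rewrite (link z) //.
    by apply/commute_sym/commuteM; [apply: commute_sym | apply: commute_refl].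
  + subst z; rewrite (link x) //.
    by apply/commuteM; [apply: commute_sym | apply: commute_refl].
have Fs : F s = s * t by rewrite FS ?/phi ?eqxx //; apply: mem_set.
have Ft : F t = t by rewrite FS ?/phi ?ts //; apply: mem_set.
have FH g : H g -> H (F g).
  move: g; apply: racg_ind; first by rewrite F1; apply: (racg1 HS).
  move=> x g Sx Hg HFg; rewrite FM //; last exact: (racg_sub HS).
  apply: (racgM HS) => //; rewrite FS; last exact: mem_set.
  by rewrite /phi; case: eqP => _; [apply: (racgM HS) | apply: (racg_sub HS)].
have FF g : H g -> F (F g) = g.
  move: g; apply: (racg_hom_eq (F := F \o F) (F' := id)) => //=.
  - by move=> g h Hg Hh; rewrite !FM //; apply: FH.
  - by rewrite !F1.
  - move=> x Sx; rewrite [F x]FS; last exact: mem_set.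
    rewrite /phi; case: eqP => [->|nx]; first by rewrite FM // Fs Ft -mulgA t2 mulg1.
    by rewrite FS ?/phi; [case: eqP | apply: mem_set].
have Fst : F (s * t) = s by rewrite FM // Fs Ft -mulgA t2 mulg1.
have Hst := racgM HS Hs Ht.
have : commute (F y) s by rewrite -Fst /commute -!FM // cy.
case/(cent _ (FH _ Hy)) => e; rewrite -(FF _ Hy) e ?F1 ?Ft ?Fs ?Fst.
- exact: Or41.
- exact: Or42.
- exact: Or44.
- exact: Or43.
Qed.

(** Here [S] is the basis under suspicion: its letter [s] is a product of commuting involutions. The
    four-element centralizer leaves [s] exactly one neighbour, which is [a] or [c]. The transvection
    at that neighbour exchanges [s] with the other of the two, whose centralizer would then also
    have four elements; [y] and [z] witness that it is larger. *)
Lemma gen_not_pair s a c y z : S s -> H a -> H c -> s = a * c -> a * a = 1 -> c * c = 1 ->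
  commute a c -> a <> 1 -> c <> 1 ->
  (forall g, H g -> commute g s -> [\/ g = 1, g = a, g = c | g = s]) ->
  H y -> commute y a -> ~ [\/ y = 1, y = a, y = c | y = s] ->
  H z -> commute z c -> ~ [\/ z = 1, z = a, z = c | z = s] -> False.
Proof.
move=> Ss Ha Hc es a2 c2 cac a1 c1 cent Hy cya ny Hz czc nz.
have cas : commute a s by rewrite es; apply: commuteM => //.
have ccs : commute c s by rewrite es; apply: commuteM => //; apply: commute_sym.
have Hs := racg_sub HS Ss; have rs := reflection_gen HS Ss.
have [[t [St ts cts]]|nolink] := pselect (exists t, [/\ S t, t <> s & commute t s]); last first.
  (* Without a neighbour, [s] is the only possible descent of [a] and of [s * a], but these lie on
     opposite sides of its wall. *)
  have link x : S x -> commute x s -> x = s.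
    by move=> Sx cx; apply: contrapT => nx; apply: nolink; exists x.
  have [x Sx xa] := descent HS Ha a1.
  have ex := link x Sx (descent_centralizer HS Ha Ss Sx cas xa); subst x.
  have Hsa := racgM HS Hs Ha.
  have sa1 : s * a <> 1 by rewrite es cac -mulgA a2 mulg1.
  have [x Sx' xsa] := descent HS Hsa sa1.
  have csa : commute (s * a) s by apply/commute_sym/commuteM => //; apply: commute_sym.
  have ex := link x Sx' (descent_centralizer HS Hsa Ss Sx' csa xsa); subst x.
  by rewrite (side_reflM HS) // xa in xsa.
have tac x : S x -> x <> s -> commute x s -> x = a \/ x = c.
  move=> Sx xs /(cent _ (racg_sub HS Sx)) [] //; [|by left|by right].
  by move/(gen_neq1 HS Sx).
have nosum x x' : S x -> S x' -> x <> s -> x' <> s -> s <> x * x'.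
  by move=> Sx Sx' xs xs'; apply: gen_neq_mul => // /esym.
have link x : S x -> x <> s -> commute x s -> x = t.
  move=> Sx xs cx; case: (tac x Sx xs cx) => ex; case: (tac t St ts cts) => et.
  - by rewrite ex et.
  - by case: (nosum x t Sx St xs ts); rewrite ex et.
  - by case: (nosum t x St Sx ts xs); rewrite ex et.
  - by rewrite ex et.
have st : s <> t by move/esym.
have cst := commute_sym cts.
case: (tac t) => // et.
- have est : s * t = c by rewrite es et cac -mulgA a2 mulg1.
  apply: nz; have cent' g : H g -> commute g s -> [\/ g = 1, g = t, g = s | g = s * t].
    move=> Hg /(cent _ Hg); rewrite est et.
    by case=> ->; [apply: Or41 | apply: Or42 | apply: Or44 | apply: Or43].
  have cz : commute z (s * t) by rewrite est.
  have := transvection_centralizer Ss St st cst link cent' Hz cz; rewrite est et.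
  by case=> ->; [apply: Or41 | apply: Or42 | apply: Or44 | apply: Or43].
- have est : s * t = a by rewrite es et -mulgA c2 mulg1.
  apply: ny; have cent' g : H g -> commute g s -> [\/ g = 1, g = t, g = s | g = s * t].
    move=> Hg /(cent _ Hg); rewrite est et.
    by case=> ->; [apply: Or41 | apply: Or44 | apply: Or42 | apply: Or43].
  have cy : commute y (s * t) by rewrite est.
  have := transvection_centralizer Ss St st cst link cent' Hy cy; rewrite est et.
  by case=> ->; [apply: Or41 | apply: Or43 | apply: Or44 | apply: Or42].
Qed.

End Involutions.

(** * Strong rigidity *)

(* The commutation graph on S is the barycentric subdivision of the clique on V: the
   subdivision vertex c_{a,b} is the only element of S outside V commuting with a and b. *)
Record bary (G : groupType) (S V : set G) : Prop := Bary {
  bary_sub : V `<=` S;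
  bary_VV : forall x y, V x -> V y -> commute x y -> x = y;
  bary_EE : forall s t, S s -> ~ V s -> S t -> ~ V t -> commute s t -> s = t;
  bary_ends : forall s, S s -> ~ V s -> exists a b,
    [/\ V a, V b, a <> b & forall x, V x -> (commute s x <-> x = a \/ x = b)];
  bary_mid : forall a b, V a -> V b -> a <> b ->
    exists s, [/\ S s, ~ V s, commute s a & commute s b];
  bary_uniq : forall s t a b, S s -> ~ V s -> S t -> ~ V t -> V a -> V b -> a <> b ->
    commute s a -> commute s b -> commute t a -> commute t b -> s = t;
  bary_four : exists l : seq G, [/\ uniq l, size l = 4 & word_on V l]
}.

(** * Combinatorics of a subdivided clique *)

Section Bary.
Variable G : groupType.
Implicit Types (x y z r s t u g h a b c : G) (l p q : seq G).
Variables S V : set G.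
Hypothesis SV : bary S V.

Lemma bary_fresh l : (size l < 4)%N -> exists2 x, V x & x \notin l.
Proof.
have [m [um sm Vm]] := bary_four SV; move=> sl; apply: contrapT => h.
have /(uniq_leq_size um) : {subset m <= l}.
  move=> x xm; apply/negPn/negP => xl; apply: h; exists x => //; exact: Vm.
by rewrite sm leqNgt sl.
Qed.

Lemma bary_mid_only s a b x : S s -> ~ V s -> V a -> V b -> a <> b -> commute s a ->
  commute s b -> V x -> commute s x -> x = a \/ x = b.
Proof.
move=> Ss Vs Va Vb ab sa sb Vx sx.
have [a' [b' [_ _ _ E]]] := bary_ends SV Ss Vs.
move: ((E _ Va).1 sa) ((E _ Vb).1 sb) ((E _ Vx).1 sx) => ea eb ex; intuition congruence.
Qed.

Lemma bary_triangle s t u : S s -> S t -> S u -> s <> t -> t <> u -> s <> u ->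
  commute s t -> commute t u -> commute s u -> False.
Proof.
move=> Ss St Su st tu su cst ctu csu.
have [Vs|Vs] := pselect (V s); have [Vt|Vt] := pselect (V t);
  have [Vu|Vu] := pselect (V u).
- exact/st/(bary_VV SV).
- exact/st/(bary_VV SV).
- exact/su/(bary_VV SV).
- exact/tu/(bary_EE SV).
- exact/tu/(bary_VV SV).
- exact/su/(bary_EE SV).
- exact/st/(bary_EE SV).
- exact/st/(bary_EE SV).
Qed.

(** Two clique vertices outside the star of [s] are joined through their midpoint, which also avoids
    the star. A midpoint outside the star has an end outside it, for a letter that commutes with
    both ends is the midpoint itself. *)
Lemma bary_connected s (f : G -> bool) : S s ->
  (forall t t', S t -> S t' -> ~ commute s t -> ~ commute s t' -> commute t t' ->
     f t = f t') ->
  forall t t', S t -> S t' -> ~ commute s t -> ~ commute s t' -> f t = f t'.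
Proof.
move=> Ss step.
have stepV x y : V x -> V y -> ~ commute s x -> ~ commute s y -> f x = f y.
  move=> Vx Vy sx sy; have [->//|/eqP xy] := eqVneq x y.
  have [m [Sm Vm mx my]] := bary_mid SV Vx Vy xy.
  have Sx := bary_sub SV Vx; have Sy := bary_sub SV Vy.
  have sm : ~ commute s m.
    move=> csm; have [Vs|Vs] := pselect (V s).
      case: (bary_mid_only Sm Vm Vx Vy xy mx my Vs (commute_sym csm)) => e.
        by apply: sx; rewrite e.
      by apply: sy; rewrite e.
    by apply: sx; rewrite (bary_EE SV Ss Vs Sm Vm csm).
  by rewrite -(step m x) // -(step m y).
have toV t : S t -> ~ commute s t -> exists x, [/\ V x, ~ commute s x & f t = f x].
  move=> St nst; have [Vt|Vt] := pselect (V t); first by exists t.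
  have [a [b [Va Vb ab E]]] := bary_ends SV St Vt.
  have ta : commute t a by apply/E => //; left.
  have tb : commute t b by apply/E => //; right.
  have Sa := bary_sub SV Va; have Sb := bary_sub SV Vb.
  have [sa|sa] := pselect (commute s a); last by exists a; split=> //; apply: step.
  have [sb|sb] := pselect (commute s b); last by exists b; split=> //; apply: step.
  case: nst; have [Vs|Vs] := pselect (V s).
    by rewrite (bary_VV SV Vs Va sa); apply: commute_sym.
  by rewrite (bary_uniq SV Ss Vs St Vt Va Vb ab).
move=> t t' St St' nt nt'.
have [x [Vx nx ->]] := toV t St nt; have [y [Vy ny ->]] := toV t' St' nt'.
exact: stepV.
Qed.

(** A vertex and the midpoint of an edge that avoids it are at distance three, so their stars are
    disjoint. This reduces the finiteness of misoriented walls to two fixed walls. *)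
Lemma bary_far : exists t1 t2, [/\ S t1, S t2
  & forall s, S s -> ~ commute s t1 \/ ~ commute s t2].
Proof.
have [x1 V1 _] := @bary_fresh [::] isT.
have [x2 V2 n2] := @bary_fresh [:: x1] isT.
have [x3 V3 n3] := @bary_fresh [:: x1; x2] isT.
move: n2 n3; rewrite !inE => /eqP n21 /norP[/eqP n31 /eqP n32].
have n23 : x2 <> x3 by move/esym.
have [m [Sm Vm m2 m3]] := bary_mid SV V2 V3 n23.
exists x1, m; split=> //; first exact: (bary_sub SV).
have m1 : ~ commute m x1.
  by case/(bary_mid_only Sm Vm V2 V3 n23 m2 m3 V1) => /esym.
move=> s Ss; have [s1|] := pselect (commute s x1); last by left.
right=> sm; apply: m1; have [Vs|Vs] := pselect (V s).
  by rewrite -(bary_VV SV Vs V1 s1); apply: commute_sym.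
by rewrite -(bary_EE SV Ss Vs Sm Vm sm).
Qed.

Lemma bary_no_center s : S s -> exists2 x, S x & ~ commute s x.
Proof.
by move=> Ss; have [t1 [t2 [S1 S2 /(_ s Ss)[]]]] := bary_far; [exists t1 | exists t2].
Qed.

End Bary.

(** * Conjugacy of two Coxeter bases *)

Section Rigidity.
Variable G : groupType.
Implicit Types (x y z r s t u g h a b c : G) (l p q : seq G).
Variables H S V S' : set G.
Hypotheses (HS : racg H S) (SV : bary S V) (HS' : racg H S').

(** The alternative is a conjugate of [a c], with [c] the midpoint of an edge at the vertex [a].
    This product has a centralizer of order four, whereas [a] commutes with the midpoint [c'] of
    another edge at [a], and [c] with its other end [b]; so [gen_not_pair] applies to [S']. *)
Lemma gen_is_reflection s : S' s -> reflection H S s.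
Proof.
move=> Ss; have Hs := racg_sub HS' Ss.
have [u Hu [//|[a [c [Sa Sc ac cac e]]]]] :=
  involution_class HS (bary_triangle SV) Hs (racg_sq HS' Ss) (gen_neq1 HS' Ss).
  by exists u.
exfalso.
wlog Va : a c Sa Sc ac cac e / V a.
  move=> W; have [Va|Va] := pselect (V a); first exact: (W a c).
  have [Vc|Vc] := pselect (V c); last exact/ac/(bary_EE SV).
  by apply: (W c a) => //; [move/esym | rewrite -cac].
have Vc : ~ V c by move=> Vc; apply/ac/(bary_VV SV).
have [a1 [b1 [Va1 Vb1 ab1 E1]]] := bary_ends SV Sc Vc.
have [b [Vb ab cb only]] : exists b, [/\ V b, a <> b, commute c b
    & forall x, V x -> commute c x -> x = a \/ x = b].
  have [ea|ea] := (E1 a Va).1 (commute_sym cac); subst a.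
    by exists b1; split=> //; [apply/E1 => //; right | move=> x Vx /(E1 x Vx)].
  exists a1; split=> //; [by move/esym | by apply/E1 => //; left |].
  by move=> x Vx /(E1 x Vx)[]; [right | left].
have [d Vd] := @bary_fresh _ _ _ SV [:: a; b] isT.
rewrite !inE => /norP[/eqP da /eqP db].
have ad : a <> d by move/esym.
have [c' [Sc' Vc' ca' cd']] := bary_mid SV Va Vd ad.
have cc' : c' <> c by move=> e'; case: (only d Vd) => //; rewrite -e'.
have Sb := bary_sub SV Vb.
have link x : S x -> commute x a -> commute x c -> x = a \/ x = c.
  move=> Sx xa xc; have [Vx|Vx] := pselect (V x); first by left; apply: (bary_VV SV).
  by right; apply: (bary_EE SV).
have cent g : H g -> commute g (a * c) -> [\/ g = 1, g = a, g = c | g = a * c].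
  exact: (pair_centralizer HS).
have Hu' := racgV HS Hu.
have Ha := racg_sub HS Sa; have Hc := racg_sub HS Sc.
have es : s = (a ^ u^-1) * (c ^ u^-1) by rewrite -conjMg -e conjgK.
have or4J x : [\/ x = 1, x = a, x = c | x = a * c] <->
    [\/ x ^ u^-1 = 1, x ^ u^-1 = a ^ u^-1, x ^ u^-1 = c ^ u^-1 | x ^ u^-1 = s].
  rewrite es -conjMg; split=> -[e'|e'|e'|e'].
  - by apply: Or41; rewrite e' conj1g.
  - by apply: Or42; rewrite e'.
  - by apply: Or43; rewrite e'.
  - by apply: Or44; rewrite e'.
  - by apply: Or41; apply/eqP; rewrite -(conjg_eq1 _ u^-1); apply/eqP.
  - by apply: Or42; apply: conjg_inj e'.
  - by apply: Or43; apply: conjg_inj e'.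
  - by apply: Or44; apply: conjg_inj e'.
apply: (@gen_not_pair _ _ _ HS' s (a ^ u^-1) (c ^ u^-1) (c' ^ u^-1) (b ^ u^-1)) => //.
- exact: (racgJ HS).
- exact: (racgJ HS).
- exact/conjg_involution/(racg_sq HS).
- exact/conjg_involution/(racg_sq HS).
- exact/commuteJ.
- by move/eqP; rewrite conjg_eq1 => /eqP; apply: (gen_neq1 HS).
- by move/eqP; rewrite conjg_eq1 => /eqP; apply: (gen_neq1 HS).
- move=> g Hg cg; rewrite -[g](conjgK u); apply/or4J.
  by apply: cent; [apply: (racgJ HS) | rewrite -e; apply/commuteJ].
- by apply: (racgJ HS) => //; apply: (racg_sub HS).
- exact/commuteJ.
- case/or4J.
  + exact: (gen_neq1 HS).
  + by move=> ea; apply: Vc'; rewrite ea.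
  + exact: cc'.
  + by apply: (gen_neq_mul HS) => // ea; apply: Vc'; rewrite ea.
- by apply: (racgJ HS) => //; apply: (racg_sub HS).
- by apply/commuteJ/commute_sym.
- case/or4J.
  + exact: (gen_neq1 HS).
  + by move/esym.
  + by move=> eb; apply: Vc; rewrite -eb.
  + by apply: (gen_neq_mul HS) => // [/esym//|eb]; apply: Vc; rewrite -eb.
Qed.

(** Counting [s] modulo 2 is a homomorphism on [H]. Each letter of [S'] is conjugate to a letter of
    [S]; if that letter were never [s], the homomorphism would vanish on [S'], hence on [H], but its
    value at [s] is 1. *)
Lemma gen_is_reflection' s : S s -> reflection H S' s.
Proof.
move=> Ss; pose par g := odd (count_mem s (rword S g)).
have parE l : word_on S l -> par (wprod l) = odd (count_mem s l).
  by move=> Sl; have [Sr er _] := rwordP HS (racg_word HS Sl); apply: (parity HS).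
have parM g h : H g -> H h -> par (g * h) = par g (+) par h.
  move=> Hg Hh; have [Sg eg _] := rwordP HS Hg; have [Sh eh _] := rwordP HS Hh.
  rewrite -{1}eg -{1}eh -wprod_cat parE ?count_cat ?oddD //.
  by apply/word_on_cat.
have par1 : par 1 = false by rewrite (parE [::]).
have parV g : H g -> par g^-1 = par g.
  move=> Hg; have := par1; rewrite -(mulgV g) parM //; last exact: (racgV HS).
  by case: (par g); case: (par _).
have parG z : S z -> par z = (z == s).
  move=> Sz; rewrite -[z in LHS]mulg1 (parE [:: z]) /= ?addn0 ?oddb //.
  by apply/word_on_cons.
apply: contrapT => nr.
have par' z : S' z -> par z = false.
  move=> Sz; have [u Hu Szu] := gen_is_reflection Sz; have Hu' := racgV HS Hu.
  have e : z = u * (z ^ u * u^-1) by rewrite conjgE !mulgA mulgV mul1g mulgK.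
  have Hzu := racg_sub HS Szu.
  rewrite e (parM _ _ Hu (racgM HS Hzu Hu')) (parM _ _ Hzu Hu') parV //.
  rewrite (parG _ Szu); case: eqP => [ez|_]; last by case: (par _).
  by case: nr; exists u^-1; rewrite // -ez conjgK.
have par0 g : H g -> par g = false.
  move: g; apply: (racg_ind HS') => // z g Sz Hg e.
  by rewrite (parM _ _ (racg_sub HS' Sz) Hg) (par' _ Sz) e.
by have := par0 s (racg_sub HS Ss); rewrite (parG _ Ss) eqxx.
Qed.

Let refl' := gen_is_reflection'.

Let Emp := empty_quadrant H S'.

(** [eps s] is the side of [s] away from its empty quadrants. By connectedness it does not depend on
    the second wall, and uniqueness of the empty quadrant reconciles the choice made for [s] with
    that made for [t]. *)
Lemma orientation : exists eps : G -> bool, forall s t, S s -> S t -> ~ commute s t ->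
  Emp s (~~ eps s) t (~~ eps t).
Proof.
have ex s : exists e, S s -> forall t, S t -> ~ commute s t -> exists b : bool, Emp s (~~ e) t b.
  have [Ss|] := pselect (S s); last by exists true.
  pose f t := `[< exists b : bool, Emp s false t b >].
  have fN t : S t -> ~ commute s t -> ~~ f t -> exists b : bool, Emp s true t b.
    move=> St nst /asboolPn nf.
    have [[] [b hb]] := noncommuting_quadrant HS' (refl' Ss) (refl' St) nst.
      by exists b.
    by case: nf; exists b.
  have fc t t' : S t -> S t' -> ~ commute s t -> ~ commute s t' -> f t = f t'.
    apply: (bary_connected SV Ss) => {}t {}t' St St' nt nt' ctt.
    have neq : s <> t by move=> e; apply: nt; rewrite e.
    have neq' : s <> t' by move=> e; apply: nt'; rewrite e.
    case ft : (f t); case ft' : (f t') => //.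
      have /asboolP[b hb] : f t by rewrite ft.
      have [b' hb'] := fN t' St' nt' (negbT ft').
      by have := empty_quadrant_commute HS' (refl' Ss) (refl' St) (refl' St') neq ctt hb hb'.
    have /asboolP[b hb] : f t' by rewrite ft'.
    have [b' hb'] := fN t St nt (negbT ft).
    by have := empty_quadrant_commute HS' (refl' Ss) (refl' St) (refl' St') neq ctt hb' hb.
  have [x Sx nx] := bary_no_center SV Ss.
  exists (f x) => _ t St nt; rewrite (fc x t) //.
  case ft : (f t) => /=; last by apply: fN; rewrite ?ft.
  by apply/asboolP; move: ft.
have [eps epsP] := choice ex; exists eps => s t Ss St nst.
have nts : ~ commute t s by move/commute_sym.
have neq : s <> t by move=> e; apply: nst; rewrite e.
have [b hb] := epsP s Ss t St nst; have [b' hb'] := epsP t St s Ss nts.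
have [_ <-] := empty_quadrant_uniq HS' (refl' Ss) (refl' St) neq hb (empty_quadrant_sym hb').
exact: hb.
Qed.

Lemma wside_finite l : exists L : seq G, forall r, wside l r -> r \in L.
Proof.
elim: l => [|x l [L hL]]; first by exists [::].
exists (x :: [seq r ^ x^-1 | r <- L]) => r /=; rewrite /cross inE.
case: eqP => //= _ /hL rL; apply/mapP; exists (r ^ x) => //.
by rewrite conjgK.
Qed.

Section Chamber.
Variable eps : G -> bool.
Hypothesis epsP : forall s t, S s -> S t -> ~ commute s t -> Emp s (~~ eps s) t (~~ eps t).

(** Take a chamber [u] next to the wall [t]. Then [u] and [t * u] lie on both sides of [t] but on
    one side of [s], which the empty quadrant forces to be [eps s]. So a misoriented [s] that does
    not commute with [t] separates 1 from [u], and only finitely many walls do. *)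
Lemma misoriented_finite : exists L : seq G, forall s, S s -> side S' s 1 <> eps s -> s \in L.
Proof.
have [t1 [t2 [S1 S2 far]]] := bary_far SV.
have fin t : S t -> exists L : seq G, forall s, S s -> ~ commute s t -> eps s -> s \in L.
  move=> St; have [u Hu Su] := refl' St.
  have [L hL] := wside_finite (rword S' u); exists L => s Ss nst es; apply: hL.
  rewrite -/(side S' s u); have := epsP Ss St nst; rewrite es /=.
  have e : t * u = u * t ^ u by rewrite conjgE mulgA mulgV mul1g.
  have Htu : H (t * u) by apply: (racgM HS) => //; apply: (racg_sub HS).
  have s1 : side S' s (t * u) = side S' s u.
    rewrite e (side_mulr_gen HS') // (inj_eq (@conjg_inj _ u)).
    by case: eqP => [est|]; [case: nst; rewrite est | rewrite addbF].
  have s2 := side_reflM HS' (refl' St) Hu => h.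
  have := h _ Hu; have := h _ Htu; rewrite s1 s2.
  by case: (side S' s u); case: (side S' t u); case: (eps t) => //= h1 h2; exfalso; auto.
have [L1 h1] := fin t1 S1; have [L2 h2] := fin t2 S2.
exists (L1 ++ L2) => s Ss; rewrite (side1 HS') mem_cat => es.
have {}es : eps s by case: (eps s) es.
by apply/orP; case: (far s Ss) => n; [left; apply: h1 | right; apply: h2].
Qed.

(* Walk from g towards s g until the wall s is crossed: before that the walls commuting with s
   are not crossed, and those not commuting with s cannot be misoriented. *)
Lemma improve_chamber g s : H g -> S s -> side S' s g <> eps s ->
  exists2 g', H g' & side S' s g' = eps s /\
    forall t, S t -> side S' t g' = side S' t g \/ side S' t g' = eps t.
Proof.
move=> Hg Ss bad; have rs := refl' Ss; have Hs := racg_sub HS Ss.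
have Hsg : H (s ^ g) by apply: (racgJ HS).
have sl := rwordP HS' Hsg.
have sp : side S' (s ^ g) (s ^ g) by apply/(side_reflect HS')/(reflectionJ HS').
have esg : s * g = g * s ^ g by rewrite -conjgC.
have [p [z [q [e ez np]]]] := wside_split sp.
have [Sl el _] := sl; rewrite e in sl Sl.
have [Sp /word_on_cons[Sz Sq]] := (word_on_cat _ _ _).1 Sl.
have Hp := racg_word HS' Sp; have Hgp := racgM HS Hg Hp.
have sgp : side S' s (g * wprod p) = side S' s g.
  by rewrite (sideM HS') // (side_word HS') // (negPf np) addbF.
have sz t : side S' t (g * wprod p * z) = side S' t (g * wprod p) (+) (t == s).
  by rewrite (side_mulr_gen HS') // -ez -conjgM (inj_eq (@conjg_inj _ _)).
have Ees : ~~ eps s = side S' s g by move: bad; case: side; case: (eps s).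
have Hz := racg_sub HS' Sz.
exists (g * wprod p * z); first exact: (racgM HS).
split; first by rewrite sz sgp eqxx -Ees; case: (eps s).
move=> t St; rewrite sz; case: eqP => [->|ts].
  by right; rewrite sgp -Ees; case: (eps s).
rewrite addbF; have [cst|nst] := pselect (commute s t); last first.
  by right; rewrite (empty_quadrantN (epsP Ss St nst) Hgp) ?sgp ?negbK.
left; rewrite (sideM HS') // (side_word HS') //.
case tp : (wside p (t ^ g)); last by rewrite addbF.
have := shortest_cross HS' sl tp.
have : wside (p ++ z :: q) (t ^ g) = false.
  have := side_commuteM HS' (refl' St) rs ts (commute_sym cst) Hg.
  rewrite esg (sideM HS') // -e -/(side S' (t ^ g) (s ^ g)).
  by case: (side S' t g); case: side.
by rewrite wside_cat tp /= => /negbFE ->.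
Qed.

Lemma oriented_chamber : exists2 g, H g & forall s, S s -> side S' s g = eps s.
Proof.
have [L hL] := misoriented_finite.
move: (racg1 HS); move: 1 hL => g; elim: L g => [|s L IH] g hL Hg.
  by exists g => // s Ss; apply: contrapT => /(hL s Ss).
have [[Ss bad]|good] := pselect (S s /\ side S' s g <> eps s).
  have [g' Hg' [gs gt]] := improve_chamber Hg Ss bad.
  apply: (IH g') => // t St bt; have [et|nt] := eqVneq t s.
    by case: bt; rewrite et.
  case: (gt t St) => // et; have : t \in s :: L by apply: hL => //; rewrite -et.
  by rewrite inE (negPf nt).
apply: (IH g) => // t St bt; move: (hL t St bt); rewrite inE => /orP[/eqP et|//].
by case: good; rewrite -et.
Qed.

(** Strip a descent [t] of [w]. If [t] commutes with [s], crossing its wall does not affect the side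
    of [s]. Otherwise induction puts [t * w * g] on the preferred side of [t], hence [w * g] on the
    other side, and the empty quadrant decides the side of [s]. *)
Lemma ping_pong g w s : H g -> (forall x, S x -> side S' x g = eps x) ->
  H w -> S s -> side S s w = false -> side S' s (w * g) = eps s.
Proof.
move=> Hg hg; move: {2}(len S w) (leqnn (len S w)) => n.
elim: n w s => [|n IH] w s; rewrite ?leqn0 => hn Hw Ss sw.
  by move/eqP: hn => /(len_eq0 HS Hw) ->; rewrite mul1g hg.
have [->|/eqP w1] := eqVneq w 1; first by rewrite mul1g hg.
have [t St tw] := descent HS Hw w1.
have Ht := racg_sub HS St; have rt := reflection_gen HS St.
have Htw := racgM HS Ht Hw.
have ew : w = t * (t * w) by rewrite mulgA (racg_sq HS) ?mul1g.
have ltn' : (len S (t * w) <= n)%N.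
  by rewrite -ltnS; apply: leq_trans hn; apply: (len_mul_descent HS).
have ts : s <> t by move=> e; rewrite e tw in sw.
have Htwg := racgM HS Htw Hg.
have [cst|nst] := pselect (commute s t).
  rewrite ew -mulgA (side_commuteM HS' (refl' Ss) (refl' St)) //.
  by apply: IH => //; rewrite (side_commuteM HS (reflection_gen HS Ss) rt ts cst Hw).
have nts : ~ commute t s by move/commute_sym.
rewrite (empty_quadrantN (epsP St Ss nts)) ?negbK //; first exact: (racgM HS).
rewrite ew -mulgA (side_reflM HS' (refl' St)) // IH //.
by rewrite (side_reflM HS) // tw.
Qed.

End Chamber.

Theorem strong_rigidity : exists2 g, H g & forall s, S s <-> S' (s ^ g).
Proof.
have [eps epsP] := orientation.
have [g Hg gP] := oriented_chamber epsP; exists g => //.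
have Hg' := racgV HS Hg.
(* The chamber [g * s] adjacent to [g] is [w * g] with [w = s ^ g^-1]. For a descent [x] of [w],
   ping-pong puts [g * s] on the wrong side of [x]. So the wall between [g] and [g * s] is that of
   [x], and [s = x ^ g]. *)
have back s : S' s -> S (s ^ g^-1).
  move=> Ss; have Hs := racg_sub HS' Ss; have Hw := racgJ HS Hs Hg'.
  have w1 : s ^ g^-1 <> 1.
    by move/eqP; rewrite conjg_eq1 => /eqP; apply: (gen_neq1 HS').
  have [x Sx xw] := descent HS Hw w1.
  have Hx := racg_sub HS Sx; have Hxw := racgM HS Hx Hw.
  have h : side S' x (x * (s ^ g^-1) * g) = eps x.
    apply: (ping_pong epsP Hg gP) => //.
    by rewrite (side_reflM HS) ?xw //; apply: (reflection_gen HS).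
  have : side S' x (g * s) = ~~ eps x.
    rewrite -h -mulgA (side_reflM HS' (refl' Sx)) ?negbK.
      by rewrite conjgE invgK mulgA mulgVK.
    exact: (racgM HS).
  rewrite (side_mulr_gen HS') // gP //; case: eqP => [<-|]; last by case: (eps x).
  by rewrite conjgK.
move=> s; split=> [Ss|/back]; last by rewrite conjgK.
(* A letter [s] of [S] is conjugate to one of [S'], hence by [back] to a letter of [S], which can
   only be [s] itself. *)
have [u Hu Su] := refl' Ss; have := back _ Su; rewrite -conjgM => Sx.
have Hug := racgM HS Hu Hg'.
have := gen_conj HS Ss Sx Hug erefl => e.
by rewrite e conjgM conjgKV.
Qed.

End Rigidity.

(** * Subdivided cliques as Coxeter graphs *)

Lemma edge_eq (Gamma : graph) (c : {e : set (vertex Gamma) | is_edge e}) a b :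
  a <> b -> sval c a -> sval c b -> sval c = [set a; b].
Proof.
have [a' [b' [_ ->]]] := svalP c; move=> ab; rewrite /setU /set1 /= => ca cb.
by apply/funext => x; apply/propext; split=> /= hx; intuition congruence.
Qed.

Section BaryGraph.
Variable G : groupType.
Implicit Types (g h : G) (l : seq G).

Lemma K1'_bary (S : set G) : K1' (coxeter_graph S) -> exists V, bary S V.
Proof.
case=> Delta [clique four [f [[f' fK f'K] fadj]]].
have comm (v w : bary_vertex Delta) :
    commute (val (f' v)) (val (f' w)) <-> v = w \/ bary_adj v w.
  split=> [c|[->|]]; last first.
  - by rewrite -{1}(f'K v) -{1}(f'K w) => /(fadj (f' v) (f' w)).2[].
  - exact: commute_refl.
  have [->|nvw] := pselect (v = w); first by left.
  right; rewrite -(f'K v) -(f'K w); apply: (fadj (f' v) (f' w)).1; split=> //.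
  by move=> e; apply: nvw; rewrite -(f'K v) e f'K.
have Sf' v : S (val (f' v)) by apply/set_mem/valP.
have f'inj v w : val (f' v) = val (f' w) -> v = w.
  by move/val_inj => e; rewrite -(f'K v) e f'K.
pose V := [set x | exists d, x = val (f' (inl d))].
have nV s : S s -> ~ V s -> exists c, s = val (f' (inr c)).
  move=> Ss Vs; have e : s = val (f' (f (exist _ s (mem_set Ss)))) by rewrite fK.
  by case: (f _) e => [d|c] e; [case: Vs; exists d | exists c].
have VN c : ~ V (val (f' (inr c))) by case=> d /f'inj.
have cEV c d : commute (val (f' (inr c))) (val (f' (inl d))) <-> sval c d.
  by split=> [/comm[]//|cd]; apply/comm; right.
exists V; split.
- by move=> _ [d ->].
- by move=> _ _ [d ->] [d' ->] /comm[-> //|].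
- move=> s t Ss Vs St Vt; have [c ->] := nV s Ss Vs; have [c' ->] := nV t St Vt.
  by move=> /comm[->|].
- move=> s Ss Vs; have [c ->] := nV s Ss Vs.
  have [a [b [adj_ab ec]]] := svalP c.
  have ab : a <> b by move=> e; apply: (@adj_irrefl _ a); rewrite {2}e.
  exists (val (f' (inl a))), (val (f' (inl b))); split; [by exists a | by exists b | |].
    by move=> /f'inj[].
  move=> _ [d ->]; split=> [/cEV|[/f'inj[->]|/f'inj[->]]].
  + by rewrite ec => -[->|->]; [left | right].
  + by apply/cEV; rewrite ec; left.
  + by apply/cEV; rewrite ec; right.
- move=> _ _ [a ->] [b ->] nab.
  have ab : a <> b by move=> e; apply: nab; rewrite e.
  have ec : is_edge [set a; b] by exists a, b; split=> //; apply: clique.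
  exists (val (f' (inr (exist _ _ ec)))); split=> //; apply/cEV; [by left | by right].
- move=> s t _ _ Ss Vs St Vt [a ->] [b ->] nab.
  have ab : a <> b by move=> e; apply: nab; rewrite e.
  have [c ->] := nV s Ss Vs; have [c' ->] := nV t St Vt.
  move=> /cEV ca /cEV cb /cEV c'a /cEV c'b; congr (val (f' (inr _))).
  have := edge_eq ab ca cb; rewrite -(edge_eq ab c'a c'b).
  by case: (c) (c') => [e pe] [e' pe'] /= ee; apply: eq_exist.
- move/card_leP: four => [i].
  pose j (k : 'I_4) : G := val (f' (inl (val (i (exist _ k (mem_set I)))))).
  have jinj : injective j.
    move=> k k' /f'inj[] /val_inj; move/(@inj _ _ _ i); rewrite !in_setT.
    by move=> /(_ isT isT) [].
  exists (map j (enum 'I_4)); split.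
  + by rewrite map_inj_uniq // enum_uniq.
  + by rewrite size_map size_enum_ord.
  + by move=> x /mapP[k _ ->]; eexists.
Qed.

(** The subdivision of the clique on [Y] inside that on [V]: within [V] a vertex commutes only with
    itself and a midpoint only with its two ends, so one condition serves both kinds of letters. *)
Definition link_in (S V Y : set G) : set G :=
  [set s | S s /\ forall x, V x -> commute s x -> Y x].

Lemma bary_K1' (S V Y : set G) : bary S V -> Y `<=` V ->
  (exists l : seq G, [/\ uniq l, size l = 4 & word_on Y l]) ->
  K1' (coxeter_graph (link_in S V Y)).
Proof.
move=> SV YV [l [ul sl Yl]]; set S0 := link_in S V Y.
pose adj (x y : {x | Y x}) := x <> y.
have adj_sym x y : adj x y -> adj y x by move=> xy /esym.
have adj_irr x : ~ adj x x by [].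
pose Delta := Graph adj_sym adj_irr; exists Delta.
have S0P (s : S0) : S0 (val s) by apply/set_mem/valP.
have S0Y x : Y x -> S0 x.
  by move=> Yx; split=> [|y Vy /(bary_VV SV (YV _ Yx) Vy) <-//]; apply/(bary_sub SV)/YV.
split; first by [].
  have Ynth (i : 'I_4) : Y (nth 1 l i) by apply: Yl; rewrite mem_nth ?sl.
  pose j (i : 'I_4) : vertex Delta := exist _ _ (Ynth i).
  have jinj : {in [set: 'I_4] &, injective j}.
    move=> i i' _ _ [] /eqP; rewrite nth_uniq ?sl // => /eqP; exact: val_inj.
  have /card_eqPle[_ h] := inj_card_eq jinj.
  exact: card_le_trans h (subset_card_le (@subsetT _ _)).
(* The graph isomorphism as a relation; functions are chosen once it is total and single-valued in
   both directions. *)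
pose R (s : S0) (w : bary_vertex Delta) := match w with
  | inl x => val s = sval x
  | inr c => ~ V (val s) /\ forall x : {x | Y x}, sval c x <-> commute (val s) (sval x)
  end.
have Rs s : exists w, R s w.
  have [Ss supp] := S0P s; have [Vs|Vs] := pselect (V (val s)).
    by exists (inl (exist _ _ (supp _ Vs (commute_refl _)))).
  have [a [b [Va Vb ab E]]] := bary_ends SV Ss Vs.
  have Ya : Y a by apply: supp => //; apply/E => //; left.
  have Yb : Y b by apply: supp => //; apply/E => //; right.
  have ec : is_edge ([set exist _ a Ya; exist _ b Yb] : set (vertex Delta)).
    by exists (exist _ a Ya), (exist _ b Yb); split=> // -[].
  exists (inr (exist _ _ ec)); split=> // -[x Yx] /=; split.
    by case=> -[->]; apply/E; auto.
  by move/E => /(_ (YV _ Yx))[] e; subst; [left | right]; apply: eq_exist.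
have Rw w : exists s, R s w.
  case: w => [x|c].
    by exists (exist (fun y => y \in S0) (sval x) (mem_set (S0Y _ (svalP x)))).
  have [a [b [ab ec]]] := svalP c.
  have nab : sval a <> sval b.
    by move: a b ab {ec} => [a Ya] [b Yb] ab /= e; apply: ab; apply: eq_exist.
  have [s [Ss Vs sa sb]] := bary_mid SV (YV _ (svalP a)) (YV _ (svalP b)) nab.
  have only x : V x -> commute s x -> x = sval a \/ x = sval b.
    exact: (bary_mid_only SV Ss Vs (YV _ (svalP a)) (YV _ (svalP b))).
  have S0s : S0 s by split=> // x Vx /(only _ Vx)[] ->; apply: svalP.
  exists (exist _ s (mem_set S0s)); split=> //= x; rewrite ec; split.
    by case=> ->.
  move=> /(only _ (YV _ (svalP x))).
  by case: (x) (a) (b) => [x' Yx] [a' Ya] [b' Yb] /= [] e; [left | right]; apply: eq_exist.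
have Rcomm s s' w w' : R s w -> R s' w' ->
    (commute (val s) (val s') <-> val s = val s' \/ bary_adj w w').
  have [Ss _] := S0P s; have [Ss' _] := S0P s'.
  case: w w' => [x|c] [x'|c'] /=.
  - move=> -> ->; split; last by case=> [->|//]; apply: commute_refl.
    by move=> /(bary_VV SV (YV _ (svalP x)) (YV _ (svalP x'))); left.
  - move=> -> [Vs' E]; rewrite E; split; first by move/commute_sym; right.
    by case=> [e|/commute_sym//]; case: Vs'; rewrite -e; apply/YV/svalP.
  - move=> [Vs E] ->; rewrite E; split; first by right.
    by case=> [e|//]; case: Vs; rewrite e; apply/YV/svalP.
  - move=> [Vs _] [Vs' _]; split; last by case=> [->|//]; apply: commute_refl.
    by move/(bary_EE SV Ss Vs Ss' Vs'); left.
have Rfun s w w' : R s w -> R s w' -> w = w'.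
  case: w w' => [x|c] [x'|c'] /=.
  - by case: x x' => [x Yx] [x' Yx'] /= -> e; congr inl; apply: eq_exist.
  - by move=> e [Vs _]; case: Vs; rewrite (e : val s = _); apply/YV/svalP.
  - by move=> [Vs _] e; case: Vs; rewrite (e : val s = _); apply/YV/svalP.
  - move=> [_ E] [_ E']; congr inr; case: c c' E E' => [e pe] [e' pe'] /= E E'.
    apply: eq_exist; apply/funext => x; apply/propext.
    by rewrite E E'.
have Rinj s s' w : R s w -> R s' w -> s = s'.
  have [Ss _] := S0P s; have [Ss' _] := S0P s'.
  case: w => [x|c] /=; first by move=> e e'; apply: val_inj; exact: etrans e (esym e').
  move=> [Vs E] [Vs' E']; apply: val_inj.
  have [a [b [ab ec]]] := svalP c.
  have nab : sval a <> sval b.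
    by move: a b ab {ec} => [a Ya] [b Yb] ab /= e; apply: ab; apply: eq_exist.
  have ca : sval c a by rewrite ec; left.
  have cb : sval c b by rewrite ec; right.
  apply: (bary_uniq SV Ss Vs Ss' Vs' (YV _ (svalP a)) (YV _ (svalP b)) nab).
  + exact/E.
  + exact/E.
  + exact/E'.
  + exact/E'.
have [f fP] := choice Rs; have [f' f'P] := choice Rw.
exists f; split.
  exists f'.
    by move=> s; apply: (Rinj _ _ (f s)) => //; apply: f'P.
  by move=> w; apply: (Rfun (f' w)) => //; apply: f'P.
move=> s t; split=> [[st /(Rcomm _ _ _ _ (fP s) (fP t))[/val_inj//|//]]|st].
split; last by apply/(Rcomm _ _ _ _ (fP s) (fP t)); right.
by move=> e; move: st; rewrite e; apply: bary_adj_irrefl.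
Qed.

(** Deleting the letters outside [S0] turns a relator into a relator or the empty word ([s t s t]
    may become [s s]). This retraction shows that the larger presentation imposes no new relation on
    words over [S0]. *)
Lemma coxeter_basis_sub (H S S0 : set G) : coxeter_basis H S -> S0 `<=` S ->
  coxeter_basis [set g | exists2 l, word_on S0 l & wprod l = g] S0.
Proof.
move=> HS S0S; have sq := racg_sq (coxeter_basis_racg HS); case: HS => E [rH pr].
have S0P (s : S0) : S0 (val s) by apply/set_mem/valP.
pose incl (s : S0) : S := exist _ (val s) (mem_set (S0S _ (S0P s))).
pose E0 s t := E (incl s) (incl t); exists E0.
pose wincl (w : word S0) : word S := map (fun a => (incl a.1, a.2)) w.
have evalI w : word_eval (fun s : S => val s) (wincl w) = word_eval (fun s : S0 => val s) w.
  by rewrite /word_eval big_map.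
pose ret (w : word S) : word S0 :=
  pmap (fun a => omap (fun x : S0 => (x, a.2)) (insub (val a.1))) w.
have retI w : ret (wincl w) = w.
  elim: w => [//|[s e] w IH]; rewrite /ret /= -/(ret _) /=.
  have -> : insub (val s) = Some s :> option S0 by rewrite valK.
  by rewrite /= IH.
have ret_cat w w' : ret (w ++ w') = ret w ++ ret w' by rewrite /ret pmap_cat.
have wincl_cat w w' : wincl (w ++ w') = wincl w ++ wincl w' by rewrite /wincl map_cat.
split.
  apply/seteqP; split=> g.
    case=> w _ <-; exists (map (fun a => val a.1) w); first by move=> x /mapP[a _ ->].
    elim: w => [|[s e] w IH]; first by rewrite /word_eval big_nil.
    rewrite /word_eval big_cons /= -/(word_eval _ w) -IH; congr (_ * _).
    by case: e => //=; apply/esym/mulg1_eq/sq/S0S/S0P.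
  by case=> l /word_on_lift[w _ ew] <-; exists w.
have ret_eq w w' : word_eq (coxeter_relator E) w w' ->
    word_eq (coxeter_relator E0) (ret w) (ret w').
  elim=> {w w'}.
  - by move=> w; apply: word_eq_refl.
  - by move=> w1 w2 _ h; apply: word_eq_sym.
  - by move=> w1 w2 w3 _ h1 _ h2; apply: word_eq_trans h1 h2.
  - move=> u v x e; rewrite !ret_cat {2}/ret /=.
    case: insubP => [x0 _ _|_] /=; first exact: word_eq_cancel.
    exact: word_eq_refl.
  - move=> u v r hr; rewrite !ret_cat; case: r / hr => [s|s t st Est]; rewrite {2}/ret /=.
      case: insubP => [s0 _ _|_] /=; last exact: word_eq_refl.
      exact: (word_eq_relator _ _ (coxeter_relator_sq _ _)).
    case: insubP => [t0 _ et|_]; case: insubP => [s0 _ es|_] /=.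
    + apply: (word_eq_relator _ _ (coxeter_relator_comm _ _)).
        by move=> e; apply: st; apply: val_inj; exact: etrans (esym es) (etrans (congr1 val e) et).
      rewrite /E0; have -> : incl s0 = s by apply: val_inj.
      by have -> : incl t0 = t by apply: val_inj.
    + exact: (word_eq_relator _ _ (coxeter_relator_sq _ _)).
    + exact: (word_eq_relator _ _ (coxeter_relator_sq _ _)).
    + exact: word_eq_refl.
have wincl_eq w w' : word_eq (coxeter_relator E0) w w' ->
    word_eq (coxeter_relator E) (wincl w) (wincl w').
  elim=> {w w'}.
  - by move=> w; apply: word_eq_refl.
  - by move=> w1 w2 _ h; apply: word_eq_sym.
  - by move=> w1 w2 w3 _ h1 _ h2; apply: word_eq_trans h1 h2.
  - by move=> u v x e; rewrite !wincl_cat; apply: word_eq_cancel.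
  - move=> u v r hr; rewrite !wincl_cat; apply: word_eq_relator.
    case: r / hr => [s|s t st Est]; first exact: coxeter_relator_sq.
    apply: coxeter_relator_comm => // e; apply: st; apply: val_inj.
    exact: (congr1 val e).
move=> w; rewrite -evalI; split=> [/pr/ret_eq|/wincl_eq/pr //].
by rewrite retI.
Qed.

End BaryGraph.

(** * Automorphisms *)

Section ExtendInjection.
Variable T : eqType.
Implicit Types x y a b : T.

Definition swap a b x := if x == a then b else if x == b then a else x.

Lemma swapK a b : involutive (swap a b).
Proof.
move=> x; rewrite /swap; case: (eqVneq x a) => [->|xa].
  by case: (eqVneq b a) => [->|_]; rewrite ?eqxx.
by case: (eqVneq x b) => [->|/negPf xb]; rewrite ?eqxx // (negPf xa) xb.
Qed.

(** Values are corrected one at a time by the transposition of [sg a] and [f a]. Both points lie in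
    [U], and by injectivity neither is a value already prescribed. *)
Lemma extend_injection (U : set T) (f : T -> T) (l : seq T) : injective f ->
  (forall x, x \in l -> U x /\ U (f x)) ->
  exists sg tau : T -> T, [/\ cancel sg tau, cancel tau sg, forall x, ~ U x -> sg x = x
    & forall x, x \in l -> sg x = f x].
Proof.
move=> finj; elim: l => [|a l IH] hl; first by exists id, id.
have [|sg [tau [sK tK fix_ ext]]] := IH.
  by move=> x xl; apply: hl; rewrite inE xl orbT.
have [al|al] := boolP (a \in l).
  by exists sg, tau; split=> // x; rewrite inE => /orP[/eqP->|]; apply: ext.
have [Ua Ufa] : U a /\ U (f a) by apply: hl; rewrite inE eqxx.
have sU x : U x -> U (sg x).
  move=> Ux; apply: contrapT => nU; have e := fix_ _ nU.
  by apply: nU; rewrite -(can_inj sK e) in Ux.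
have neq x b : ~ U x -> U b -> (x == b) = false by move=> nU Ub; apply/eqP => e; subst.
exists (swap (sg a) (f a) \o sg), (tau \o swap (sg a) (f a)); split.
- by move=> x /=; rewrite swapK sK.
- by move=> x /=; rewrite tK swapK.
- by move=> x nU /=; rewrite (fix_ x nU) /swap !neq //; apply: sU.
move=> x; rewrite inE => /orP[/eqP->|xl] /=; first by rewrite /swap eqxx.
have xa : (x == a) = false by apply: contraNF al => /eqP <-.
rewrite /swap (inj_eq (can_inj sK)) xa ext // (inj_eq finj) xa //.
Qed.

End ExtendInjection.

Section Automorphisms.
Variable G : groupType.
Implicit Types (x y s t g h : G) (l : seq G).

Lemma morph_commute (F : G -> G) x y : injective F -> {morph F : x y / x * y} ->
  commute (F x) (F y) <-> commute x y.
Proof. by move=> Fi FM; rewrite /commute -!FM; split=> [/Fi|->]. Qed.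

Lemma bary_image (F : G -> G) (S V : set G) : injective F -> {morph F : x y / x * y} ->
  bary S V -> bary (F @` S) (F @` V).
Proof.
move=> Fi FM SV; have cF x y := morph_commute x y Fi FM.
have VF x : (F @` V) (F x) -> V x by case=> y Vy /Fi <-.
have nVF x : ~ (F @` V) (F x) -> ~ V x by move=> nV Vx; apply: nV; exact: imageP.
split.
- by move=> _ [x Vx <-]; exists x => //; apply: (bary_sub SV).
- by move=> _ _ [x Vx <-] [y Vy <-] /cF/(bary_VV SV Vx Vy) ->.
- by move=> _ _ [s Ss <-] /nVF Vs [t St <-] /nVF Vt /cF/(bary_EE SV Ss Vs St Vt) ->.
- move=> _ [s Ss <-] /nVF Vs.
  have [a [b [Va Vb ab E]]] := bary_ends SV Ss Vs.
  exists (F a), (F b); split; [exact: imageP | exact: imageP | by move/Fi |].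
  move=> _ [x Vx <-]; rewrite cF E //.
  by split=> [[->|->]|[/Fi->|/Fi->]]; auto.
- move=> _ _ [a Va <-] [b Vb <-] nab.
  have ab : a <> b by move=> e; apply: nab; rewrite e.
  have [s [Ss Vs sa sb]] := bary_mid SV Va Vb ab.
  by exists (F s); split; [exact: imageP | move/VF | apply/cF | apply/cF].
- move=> _ _ _ _ [s Ss <-] /nVF Vs [t St <-] /nVF Vt [a Va <-] [b Vb <-] nab.
  have ab : a <> b by move=> e; apply: nab; rewrite e.
  by move=> /cF sa /cF sb /cF ta /cF tb; rewrite (bary_uniq SV Ss Vs St Vt Va Vb).
- have [l [ul sl Vl]] := bary_four SV; exists (map F l); split.
  + by rewrite map_inj_uniq.
  + by rewrite size_map.
  + by move=> x /mapP[y yl ->]; apply: imageP; apply: Vl.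
Qed.

Lemma wprod_map (F : G -> G) l : F 1 = 1 -> {morph F : x y / x * y} ->
  wprod (map F l) = F (wprod l).
Proof. by move=> F1 FM; elim: l => //= x l ->; rewrite FM. Qed.

Lemma morph1 (F : G -> G) : {morph F : x y / x * y} -> F 1 = 1.
Proof. by move=> FM; apply: (@mulgI _ (F 1)); rewrite -FM !mulg1. Qed.

Lemma racg_image (F : G -> G) (S : set G) : automorphism F -> racg [set: G] S ->
  racg [set: G] (F @` S).
Proof.
move=> [Fb FM] HS; have Fi := bij_inj Fb; have F1 := morph1 FM.
case: Fb => F' FK F'K.
have cF x y := morph_commute x y Fi FM.
have unmap l : word_on (F @` S) l -> exists2 l', word_on S l' & l = map F l'.
  elim: l => [|x l IH]; first by exists [::].
  move=> /word_on_cons[[y Sy <-] /IH[l' Sl' ->]].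
  by exists (y :: l') => //; apply/word_on_cons.
split.
- move=> g; split=> // _; have /(racg_gen HS)[l Sl el] : [set: G] (F' g) by [].
  exists (map F l); last by rewrite wprod_map // el F'K.
  by move=> _ /mapP[x xl ->]; apply/imageP/Sl.
- by move=> _ [s Ss <-]; rewrite -FM (racg_sq HS Ss).
- move=> T f fK fC l l' z /unmap[m Sm ->] /unmap[m' Sm' ->].
  rewrite !wprod_map // => /Fi e.
  have fE w : foldr f z (map F w) = foldr (f \o F) z w by elim: w => //= x w ->.
  rewrite !fE; apply: (racg_univ HS) => //.
    by move=> s Ss; apply: fK; apply: imageP.
  move=> s t Ss St st c; apply: fC; [exact: imageP | exact: imageP | by move/Fi |].
  exact/cF.
Qed.

Section SubBasis.
Variables S V : set G.
Hypothesis SV : bary S V.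

Lemma bary_three s a b c : S s -> V a -> V b -> V c -> a <> b -> a <> c -> b <> c ->
  commute s a -> commute s b -> commute s c -> False.
Proof.
move=> Ss Va Vb Vc ab ac bc sa sb sc; have [Vs|Vs] := pselect (V s).
  by apply: ab; rewrite -(bary_VV SV Vs Va sa) (bary_VV SV Vs Vb sb).
by case: (bary_mid_only SV Ss Vs Va Vb ab sa sb Vc sc) => [/esym|/esym].
Qed.

(* An element of V1 commutes with at least three others, an element of S outside V with two. *)
Lemma sub_bary S1 V1 : S1 `<=` S -> bary S1 V1 ->
  V1 = V `&` S1 /\ S1 = link_in S V V1.
Proof.
move=> S1S SV1.
have VV1 x : V1 x -> V x.
  move=> V1x; apply: contrapT => nVx.
  have Sx := S1S _ (bary_sub SV1 V1x).
  have [y1 Vy1] := @bary_fresh _ _ _ SV1 [:: x] isT.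
  have [y2 Vy2] := @bary_fresh _ _ _ SV1 [:: x; y1] isT.
  have [y3 Vy3] := @bary_fresh _ _ _ SV1 [:: x; y1; y2] isT.
  rewrite !inE => /norP[/eqP n3x /norP[/eqP n31 /eqP n32]].
  move=> /norP[/eqP n2x /eqP n21] /eqP n1x.
  have mid y : V1 y -> y <> x -> exists m, [/\ V m, commute x m, commute m y
      & forall z, V1 z -> commute m z -> z = x \/ z = y].
    move=> V1y yx; have xy : x <> y by move/esym.
    have [m [Sm V1m mx my]] := bary_mid SV1 V1x V1y xy.
    exists m; split=> //.
    - apply: contrapT => Vm; apply: V1m.
      by rewrite (bary_EE SV (S1S _ Sm) Vm Sx nVx mx).
    - by move=> z; apply: (bary_mid_only SV1 Sm V1m V1x V1y xy mx my).
  have [m1 [Vm1 c1 d1 o1]] := mid _ Vy1 n1x.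
  have [m2 [Vm2 c2 d2 o2]] := mid _ Vy2 n2x.
  have [m3 [Vm3 c3 d3 o3]] := mid _ Vy3 n3x.
  apply: (bary_three Sx Vm1 Vm2 Vm3) => // e.
  + by rewrite e in d1; case: (o2 _ Vy1 d1) => // /esym.
  + by rewrite e in d1; case: (o3 _ Vy1 d1) => // /esym.
  + by rewrite e in d2; case: (o3 _ Vy2 d2) => // /esym.
have V1V x : S1 x -> V x -> V1 x.
  move=> Sx Vx; apply: contrapT => V1x.
  have [a [b [Va Vb ab E]]] := bary_ends SV1 Sx V1x.
  apply: ab; rewrite -(bary_VV SV Vx (VV1 _ Va)); last by apply/E => //; left.
  by apply: (bary_VV SV Vx (VV1 _ Vb)); apply/E => //; right.
split; apply/seteqP; split=> x.
- by move=> V1x; split; [apply: VV1 | apply: (bary_sub SV1)].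
- by case=> Vx Sx; apply: V1V.
- move=> S1x; split; first exact: S1S.
  move=> y Vy c; have [Vx|Vx] := pselect (V x).
    by rewrite -(bary_VV SV Vx Vy c); apply: V1V.
  have V1x : ~ V1 x by move/VV1.
  have [a [b [Va Vb ab E]]] := bary_ends SV1 S1x V1x.
  have xa : commute x a by apply/E => //; left.
  have xb : commute x b by apply/E => //; right.
  by case: (bary_mid_only SV (S1S _ S1x) Vx (VV1 _ Va) (VV1 _ Vb) ab xa xb Vy c) => ->.
- case=> Sx supp; have [Vx|Vx] := pselect (V x).
    by apply: (bary_sub SV1); apply: supp => //; apply: commute_refl.
  have [a [b [Va Vb ab E]]] := bary_ends SV Sx Vx.
  have xa : commute x a by apply/E => //; left.
  have xb : commute x b by apply/E => //; right.
  have V1a := supp _ Va xa; have V1b := supp _ Vb xb.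
  have [m [S1m V1m ma mb]] := bary_mid SV1 V1a V1b ab.
  have Vm : ~ V m by move=> Vm; apply: V1m; apply: V1V.
  by rewrite (bary_uniq SV Sx Vx (S1S _ S1m) Vm Va Vb ab).
Qed.

(** A letter is determined by being a vertex or a midpoint together with the vertices it commutes
    with; so automorphisms that induce the same map on those vertices agree on the letter. *)
Lemma link_uniq (sg : G -> G) s t t' : {in V &, injective sg} ->
  (forall x, V x -> V (sg x)) -> S s -> S t -> S t' -> (V t <-> V s) -> (V t' <-> V s) ->
  (forall x, V x -> commute s x -> commute t (sg x)) ->
  (forall x, V x -> commute s x -> commute t' (sg x)) -> t = t'.
Proof.
move=> si sV Ss St St' ts ts' ct ct'; have [Vs|Vs] := pselect (V s).
  have e := bary_VV SV (ts.2 Vs) (sV _ Vs) (ct _ Vs (commute_refl s)).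
  by have e' := bary_VV SV (ts'.2 Vs) (sV _ Vs) (ct' _ Vs (commute_refl s)); rewrite e e'.
have Vt : ~ V t by move/ts.
have Vt' : ~ V t' by move/ts'.
have [a [b [Va Vb ab E]]] := bary_ends SV Ss Vs.
have sa : commute s a by apply/E => //; left.
have sb : commute s b by apply/E => //; right.
apply: (bary_uniq SV St Vt St' Vt' (sV _ Va) (sV _ Vb)).
- by move/si => e; apply: ab; apply: e; apply: mem_set.
- exact: ct.
- exact: ct.
- exact: ct'.
- exact: ct'.
Qed.

(** A vertex permutation acts on midpoints and so on all letters. The homomorphisms obtained from
    [sg] and [tau] are mutually inverse because their composite fixes the vertices near each letter,
    hence the letter. *)
Lemma perm_automorphism (sg tau : G -> G) : racg [set: G] S ->
  cancel sg tau -> cancel tau sg -> (forall x, V x -> V (sg x)) ->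
  (forall x, V x -> V (tau x)) ->
  exists F : G -> G, automorphism F /\
    forall s, S s -> [/\ S (F s), V (F s) <-> V s
      & forall x, V x -> commute s x -> commute (F s) (sg x)].
Proof.
move=> HS.
pose ok f (sg : G -> G) := forall s, S s -> [/\ S (f s), V (f s) <-> V s
  & forall x, V x -> commute s x -> commute (f s) (sg x)].
have exf (f : G -> G) : injective f -> (forall x, V x -> V (f x)) -> exists phi, ok phi f.
  move=> fi fV.
  have ex s : exists t, S s -> [/\ S t, V t <-> V s
      & forall x, V x -> commute s x -> commute t (f x)].
    have [Ss|] := pselect (S s); last by exists 1.
    have [Vs|Vs] := pselect (V s).
      exists (f s) => _; split; [exact/(bary_sub SV)/fV | by split=> // _; apply: fV |].
      by move=> x Vx c; rewrite -(bary_VV SV Vs Vx c); apply: commute_refl.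
    have [a [b [Va Vb ab E]]] := bary_ends SV Ss Vs.
    have nf : f a <> f b by move/fi.
    have [t [St Vt ta tb]] := bary_mid SV (fV _ Va) (fV _ Vb) nf.
    by exists t => _; split=> // x Vx /(E _ Vx)[] ->.
  by have [phi hphi] := choice ex; exists phi.
have homf (f phi : G -> G) : injective f -> (forall x, V x -> V (f x)) -> ok phi f ->
    exists F : G -> G, {in S, F =1 phi} /\ {morph F : x y / x * y}.
  move=> fi fV okp.
  have [||F [FS FM _]] := @racg_hom _ _ _ HS G phi.
  - by move=> s Ss; have [Sp _ _] := okp s Ss; apply: (racg_sq HS).
  - have half s t : S s -> S t -> V s -> commute s t -> commute (phi s) (phi t).
      move=> Ss St Vs c; have [_ _ ct] := okp t St; have [_ Vps cs] := okp s Ss.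
      have -> := bary_VV SV (Vps.2 Vs) (fV _ Vs) (cs _ Vs (commute_refl s)).
      by apply/commute_sym/ct => //; apply: commute_sym.
    move=> s t Ss St st c; have [Vs|Vs] := pselect (V s); first exact: half.
    have [Vt|Vt] := pselect (V t).
      by apply: commute_sym; apply: half => //; apply: commute_sym.
    by case: st; apply: (bary_EE SV).
  by exists F; split=> // x y; apply: FM.
move=> sK tK sV tV; have si := can_inj sK; have ti := can_inj tK.
have [phi okp] := exf sg si sV; have [psi okq] := exf tau ti tV.
have [F [FS FM]] := homf sg phi si sV okp; have [F' [FS' FM']] := homf tau psi ti tV okq.
have comp (f f' p p' D D' : G -> G) : (forall x, V x -> V (f x)) -> cancel f f' ->
    ok p f -> ok p' f' ->
    {in S, D =1 p} -> {morph D : x y / x * y} ->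
    {in S, D' =1 p'} -> {morph D' : x y / x * y} -> cancel D D'.
  move=> fV fK okp' okq' DS DM DS' DM' g.
  apply: (racg_hom_eq HS (F := D' \o D) (F' := id)) => //=.
  - by move=> x y _ _; rewrite DM DM'.
  - by rewrite !morph1.
  move=> s Ss; rewrite DS ?mem_set //.
  have [Sp Vp cp] := okp' s Ss; have [Sq Vq cq] := okq' _ Sp.
  rewrite DS' ?mem_set //; apply: (link_uniq (sg := id) (s := s)) => //.
    by rewrite Vq.
  by move=> x Vx c; have := cq (f x) (fV _ Vx) (cp _ Vx c); rewrite fK.
exists F; split; last by move=> s Ss; rewrite FS ?mem_set //; apply: okp.
split=> //; exists F'.
- exact: (comp sg tau phi psi).
- exact: (comp tau sg psi phi).
Qed.

End SubBasis.
End Automorphisms.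

(** * Tameness *)

Section Tameness.
Variable G : groupType.
Implicit Types (x y s t g h : G) (l : seq G).

(** The basis that witnesses [K1 H] need not be [S]; rigidity conjugates one to the other and
    carries the vertex set along. *)
Lemma K1_bary (H S : set G) : K1 H -> coxeter_basis H S -> exists V, bary S V.
Proof.
move=> [T [/coxeter_basis_racg HT /K1'_bary[V TV]]] /coxeter_basis_racg HS.
have [g Hg gP] := strong_rigidity HT TV HS.
exists ((conjg^~ g) @` V); have -> : S = (conjg^~ g) @` T.
  apply/seteqP; split=> [s Ss|_ [s Ts <-]]; last exact/gP.
  by exists (s ^ g^-1); [apply/gP; rewrite conjgKV | rewrite conjgKV].
by apply: bary_image => //; [exact: conjg_inj | move=> x y; apply: conjMg].
Qed.

Lemma countable_span (S : set G) (L : seq G) : (forall s, S s -> s \in L) ->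
  countable [set g | exists2 l, word_on S l & wprod l = g].
Proof.
move=> SL; pose f (w : seq nat) : G := wprod (map (nth 1 L) w).
apply: (@sub_countable _ _ _ [set: seq nat]); last exact: countableP.
apply: card_le_trans (card_image_le f _); apply: subset_card_le => _ [l Sl <-].
exists (map (index^~ L) l) => //; rewrite /f -map_comp; congr wprod.
by rewrite -[RHS]map_id; apply/eq_in_map => x /Sl/SL xL /=; rewrite nth_index.
Qed.

Section Bary.
Variables S V : set G.
Hypotheses (HS : racg [set: G] S) (SV : bary S V).

Lemma link_finite Y (L : seq G) : Y `<=` V -> (forall x, Y x -> x \in L) ->
  exists L' : seq G, forall s, link_in S V Y s -> s \in L'.
Proof.
move=> YV YL.
have ex (p : G * G) : exists m, forall s, S s -> ~ V s -> V p.1 -> V p.2 -> p.1 <> p.2 ->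
    commute s p.1 -> commute s p.2 -> s = m.
  have [[m hm]|h] := pselect (exists m,
      [/\ S m, ~ V m, commute m p.1 & commute m p.2]).
    exists m => s Ss Vs V1 V2 n c1 c2; case: hm => Sm Vm d1 d2.
    exact: (bary_uniq SV Ss Vs Sm Vm V1 V2).
  by exists 1 => s Ss Vs _ _ _ c1 c2; case: h; exists s.
have [mid midP] := choice ex.
exists (L ++ [seq mid (x, y) | x <- L, y <- L]) => s [Ss h]; rewrite mem_cat.
have [Vs|Vs] := pselect (V s).
  by rewrite YL //; apply: h => //; apply: commute_refl.
have [a [b [Va Vb ab E]]] := bary_ends SV Ss Vs.
have sa : commute s a by apply/E => //; left.
have sb : commute s b by apply/E => //; right.
rewrite (midP (a, b) s) //; apply/orP; right.
by apply/allpairsP; exists (a, b); split=> //=; apply: YL; apply: h.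
Qed.

Lemma ends_finite : exists e : G -> seq G,
  forall s x, S s -> V x -> commute s x -> x \in e s.
Proof.
have ex s : exists e : seq G, S s -> forall x, V x -> commute s x -> x \in e.
  have [Ss|] := pselect (S s); last by exists [::].
  have [Vs|Vs] := pselect (V s).
    by exists [:: s] => _ x Vx /(bary_VV SV Vs Vx) ->; rewrite inE.
  have [a [b [_ _ _ E]]] := bary_ends SV Ss Vs.
  by exists [:: a; b] => _ x Vx /(E x Vx)[] ->; rewrite !inE eqxx ?orbT.
by have [e eP] := choice ex; exists e => s x Ss; apply: eP.
Qed.

(** * Automorphisms that fix a special subgroup *)

Section FixingAutomorphism.
Variables (Y0 : set G) (F : G -> G).
Hypotheses (Y0V : Y0 `<=` V) (Faut : automorphism F).
Hypothesis four : exists l : seq G, [/\ uniq l, size l = 4 & word_on Y0 l].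
Hypothesis Ffix : forall s, link_in S V Y0 s -> F s = s.

(** The image of [S] is conjugate to [S] by some [g]. A fixed letter and its conjugate by [g] are
    both in the image, hence equal, so [g] commutes with it. A descent of [g] would then commute
    with three vertices of [Y0], which no letter does; so [g = 1]. *)
Lemma fixing_automorphism_basis : F @` S = S /\ F @` V = V.
Proof.
have [Fb FM] := Faut; have Fi := bij_inj Fb.
have HFS := racg_image Faut HS.
have [g _ gP] := strong_rigidity HS SV HFS.
have cg s : link_in S V Y0 s -> commute g s.
  move=> S0s; have [Ss _] := S0s; have Fs := Ffix S0s.
  have FSs : (F @` S) s by exists s.
  by apply/commute_sym/commuteE/esym/(gen_conj HFS FSs ((gP s).1 Ss) (I : [set: G] g)).
have g1 : g = 1.
  apply: contrapT => g1; have [t St tg] := descent HS (I : [set: G] g) g1.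
  have ct x : Y0 x -> commute t x.
    move=> Yx; have Vx := Y0V Yx; have Sx := bary_sub SV Vx.
    apply: (descent_centralizer HS (I : [set: G] g)) => //; apply: cg.
    by split=> // y Vy /(bary_VV SV Vx Vy) <-.
  have [l [ul sl Yl]] := four; case: l ul sl Yl => [|x1 [|x2 [|x3 l]]] //=.
  rewrite !inE => /and4P[/norP[/eqP n12 /norP[/eqP n13 _]] /norP[/eqP n23 _] _ _] _ Yl.
  have Y1 : Y0 x1 by apply: Yl; rewrite !inE eqxx.
  have Y2 : Y0 x2 by apply: Yl; rewrite !inE eqxx orbT.
  have Y3 : Y0 x3 by apply: Yl; rewrite !inE eqxx !orbT.
  by apply: (bary_three SV St (Y0V Y1) (Y0V Y2) (Y0V Y3)) => //; apply: ct.
have eS : F @` S = S.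
  by apply/seteqP; split=> s; [move=> h; apply/gP | move/gP]; rewrite g1 conjg1.
split=> //; have FV := bary_image Fi FM SV; rewrite eS in FV.
(* Both [V] and its image serve as vertex sets for the same [S], which determines its vertex set. *)
have [e _] := sub_bary SV (@subset_refl _ S) FV.
by rewrite e; apply/seteqP; split=> [x []//|x Vx]; split=> //; apply: (bary_sub SV).
Qed.

(* Deleting from a word of g the letters whose F-image is not a letter of a given word of
   F g does not change g, because deletion of letters is a retraction. *)
Lemma fixing_word (Z : set G) g m : word_on (link_in S V Z) m -> wprod m = F g ->
  wprod [seq s <- rword S g | `[< link_in S V Z (F s) >]] = g.
Proof.
move=> Zm em; have [eFS _] := fixing_automorphism_basis.
have [Fb FM] := Faut; have Fi := bij_inj Fb; have F1 := morph1 FM.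
have [Sl el _] := rwordP HS (I : [set: G] g).
pose P x := `[< link_in S V Z x >].
pose f x k := if P x then x * k else k.
have fE w : foldr f 1 w = wprod [seq s <- w | P s].
  by elim: w => //= x w ->; rewrite /f; case: (P x).
have SFl : word_on S (map F (rword S g)).
  by move=> _ /mapP[x /Sl Sx ->]; rewrite -eFS; apply: imageP.
have Sm : word_on S m by move=> x /Zm[].
have : foldr f 1 (map F (rword S g)) = foldr f 1 m.
  apply: (racg_univ HS) => //.
  - by move=> s Ss k; rewrite /f; case: (P s); rewrite // mulgA (racg_sq HS) // mul1g.
  - move=> s t _ _ _ c k; rewrite /f; case: (P s); case: (P t) => //.
    by rewrite !mulgA c.
  - by rewrite wprod_map // el em.
rewrite !fE filter_map wprod_map // => e; apply: Fi; rewrite [LHS]e -em; congr wprod.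
by apply/all_filterP/allP => x /Zm h; apply/asboolP.
Qed.

End FixingAutomorphism.
End Bary.
End Tameness.

Theorem theorem5p12 (kappa : Type) (M : groupType)
  (hM : monster K1 strong kappa M) : tame K1 strong M.
Proof.
move: hM => [_ KM _ _] B KB _ [_ subB [S [MS BS]]] a b nsame.
have HS := coxeter_basis_racg MS; have [V SV] := K1_bary KM MS.
have HS1 := coxeter_basis_racg BS; have [Y SY] := K1_bary KB BS.
have [eY eS1] := sub_bary SV (@subIsetr _ B S) SY.
have YV : Y `<=` V by rewrite eY => x [].
have [e eP] := ends_finite SV.
(* The support of a tuple: all vertices on which the letters of the chosen words depend. *)
pose Z (c : seq M) := flatten (map e (flatten (map (rword S) c))).
have ZP c g s x : g \in c -> s \in rword S g -> V x -> commute s x -> x \in Z c.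
  move=> gc sg Vx sx; have [Sg _ _] := rwordP HS (I : [set: M] g).
  apply/flattenP; exists (e s); last exact: (eP _ _ (Sg _ sg)).
  by apply: map_f; apply/flattenP; exists (rword S g) => //; apply: map_f.
have [l4 [u4 s4 Y4]] := bary_four SY.
(* [l4] provides the four vertices that put [A] in [K1] and make the automorphism respect the basis;
   the supports ensure that all their vertices in [Y] are fixed. *)
pose L := l4 ++ Z a ++ Z b.
pose Y0 := [set x | Y x /\ x \in L].
have Y0Y : Y0 `<=` Y by move=> x [].
have Y0V : Y0 `<=` V by move=> x /Y0Y/YV.
have four : exists l : seq M, [/\ uniq l, size l = 4 & word_on Y0 l].
  exists l4; split=> // x xl; split; first exact: Y4.
  by rewrite mem_cat xl.
set S0 := link_in S V Y0.
have S01 : S0 `<=` B `&` S.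
  by rewrite eS1 => s [Ss h]; split=> // x Vx /(h x Vx)/Y0Y.
have S0S : S0 `<=` S by move=> s [].
pose A := [set g | exists2 l, word_on S0 l & wprod l = g].
have bA : coxeter_basis A S0 := coxeter_basis_sub MS S0S.
have HA := coxeter_basis_racg bA.
have [L0 hL0] := link_finite SV Y0V (fun x (h : Y0 x) => proj2 h).
exists A; split.
- by exists S0; split=> //; apply: bary_K1'.
- exact: countable_span hL0.
- split.
  + move=> _ [l Sl <-]; apply: (racg_word HS1) => x /Sl; exact: S01.
  + split; [exact: (racg1 HA) | by move=> x y; apply: (racgM HA) |].
    by move=> x; apply: (racgV HA).
  + exists (B `&` S); split=> //.
    have -> // : A `&` (B `&` S) = S0.
    apply/seteqP; split=> [s [[l Sl el] [_ Ss]]|s S0s].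
      exact: (span_gen HS S0S Sl).
    by split; [exact: (racg_sub HA) | exact: S01].
move=> [F [Faut Ffix Fab]]; apply: nsame.
have Ffix0 s : S0 s -> F s = s by move=> S0s; apply/Ffix/mem_set/(racg_sub HA).
have [Fb FM] := Faut; have Fi := bij_inj Fb.
have [eFS eFV] := fixing_automorphism_basis HS SV Y0V Faut four Ffix0.
have FV x : V x -> V (F x) by move=> Vx; rewrite -eFV; apply: imageP.
have FS x : S x -> S (F x) by move=> Sx; rewrite -eFS; apply: imageP.
have FVi x : V (F x) -> V x by rewrite -{1}eFV => -[y Vy /Fi <-].
pose U := V `\` Y.
(* Only vertices that stay outside [Y] under [F] are prescribed: support vertices in [Y] are fixed
   by [F], and those sent into [Y] from outside occur in no letter that survives the deletion
   below. *)
pose l1 := [seq x <- Z a | `[< U x /\ U (F x) >]].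
have [|sg [tau [sK tK sfix sext]]] := @extend_injection _ U F l1 Fi.
  by move=> x; rewrite mem_filter => /andP[/asboolP].
have nU x : ~ V x -> ~ U x by move=> h [].
have sV x : V x -> V (sg x).
  move=> Vx; apply: contrapT => h; apply: (h).
  by rewrite -(can_inj sK (sfix _ (nU _ h))) in Vx.
have tV x : V x -> V (tau x).
  by move=> Vx; apply: contrapT => h; apply: (h); rewrite -(sfix _ (nU _ h)) tK.
have [F' [Faut' F'P]] := perm_automorphism SV HS sK tK sV tV.
have [Fb' FM'] := Faut'; have Fi' := bij_inj Fb'.
have sgY x : Y x -> sg x = x by move=> Yx; apply: sfix => -[].
have sgi : {in V &, injective sg} by move=> x y _ _; apply: (can_inj sK).
exists F'; split=> //.
- move=> x /set_mem Bx.
  apply: (racg_hom_eq HS1 (F := F') (F' := id)) => //.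
    exact: morph1.
  move=> s; rewrite {1}eS1 => -[Ss h]; have [S' V' c'] := F'P s Ss.
  (* The vertices commuting with a letter of [B] lie in [Y], where [sg] is the identity. *)
  apply: (link_uniq SV sgi sV Ss) => // y Vy c.
  by rewrite sgY //; apply: h.
rewrite -Fab; apply/eq_in_map => g ga.
pose W := [set x | x \in Z b].
have gb : F g \in b by rewrite -Fab; apply: map_f.
have [Sm em _] := rwordP HS (I : [set: M] (F g)).
have Wm : word_on (link_in S V W) (rword S (F g)).
  by move=> s sm; split=> [|x Vx c]; [apply: Sm | apply: (ZP b (F g) s)].
(* The chosen word of [F g] need not be the image of that of [g]. Deletion leaves a word for [g]
   whose letters have images supported in [Z b]. *)
have eg := fixing_word HS SV Y0V Faut four Ffix0 Wm em.
have [Sl _ _] := rwordP HS (I : [set: M] g).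
rewrite -eg -!wprod_map //; try exact: morph1.
congr wprod; apply/eq_in_map => s; rewrite mem_filter => /andP[/asboolP[_ Ws] sl].
have Ss := Sl _ sl; have [S' V' c'] := F'P s Ss.
have sgF x : V x -> commute s x -> sg x = F x.
  move=> Vx c; have xZ : x \in Z a by apply: (ZP a g s).
  have xL : x \in L by rewrite !mem_cat xZ orbT.
  have [Yx|Yx] := pselect (Y x).
    rewrite sgY // Ffix0 //; split; first exact: (bary_sub SV).
    by move=> y Vy /(bary_VV SV Vx Vy) <-.
  apply: sext; rewrite mem_filter xZ andbT; apply/asboolP; split; first by [].
  split; first exact: FV.
  (* If [F x] were in [Y], it would lie in [Y0], being in the support of [b], and so be fixed;
     injectivity then gives [F x = x], although [x] is not in [Y]. *)
  move=> YFx; have FZ : F x \in Z b.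
    by apply: Ws; [exact: FV | apply/(morph_commute _ _ Fi FM)].
  have /Ffix0/Fi Fxx : S0 (F x).
    split; first exact/FS/(bary_sub SV).
    move=> y Vy /(bary_VV SV (FV _ Vx) Vy) <-; split=> //.
    by rewrite !mem_cat FZ !orbT.
  by apply: Yx; rewrite -Fxx.
apply: (link_uniq SV sgi sV Ss) => //; [exact: FS | by split=> [/FVi|/FV] |].
by move=> x Vx c; rewrite sgF //; apply/(morph_commute _ _ Fi FM).
Qed.
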